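(* Let $S=S^{n-1}\subset\mathbb R^n$ be the unit sphere with normalized surface measure $\lambda$, and let $\mu$ be a probability measure on $S$ with density $f$ with respect to $\lambda$ satisfying $0<m\le f\le M<\infty$; let $g=1/f$. For a positive integer $d$ set $k=\lfloor d^{4/3}\rfloor$, $\phi_{x,k}(y)=\left(\frac{\langle x,y\rangle+1}{2}\right)^k$, $h_{x,k}=\phi_{x,k}/f$, and $$\widehat g_d(x)=\frac{\|\Pi_dh_{x,k}\|^2_{\mathscr L^2(\mu)}}{\|\phi_{x,k}\|^2_{\mathscr L^2(\lambda)}},$$ where $\Pi_d$ is the $\mathscr L^2(\mu)$-orthogonal projection onto spherical polynomials of degree at most $d$. Then, uniformly in $x\in S$: if $g\in C^1(S)$, $|\widehat g_d(x)-g(x)|=O(d^{-2/3})$; if $g\in C^2(S)$, $|\widehat g_d(x)-g(x)|=O(d^{-4/3})$. The implicit constants depend only on $n$, $m$, $M$ and the Sobolev/bounded-derivative constants of $g$.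
   Context: Spherical polynomials of degree at most $d$ are restrictions to $S$ of real polynomials of degree at most $d$ on $\mathbb R^n$. *)

(* Defs.v *)
From HB Require Import structures.
From mathcomp Require Import all_boot all_order all_algebra.
From mathcomp Require Import all_classical all_reals all_analysis.
Import Order.TTheory GRing.Theory Num.Theory.
Set Implicit Arguments.
Unset Strict Implicit.
Unset Printing Implicit Defensive.
Local Open Scope ring_scope.

Definition dotv (R : realType) (n : nat) (x y : 'rV[R]_n) : R :=
  \sum_(i < n) x 0 i * y 0 i.
Definition enorm (R : realType) (n : nat) (x : 'rV[R]_n) : R :=
  Num.sqrt (dotv x x).

Definition sphere (R : realType) (n : nat) : set 'rV[R]_n :=
  [set x | dotv x x = 1].

Definition radial (R : realType) (n : nat) (y : 'rV[R]_n) : 'rV[R]_n :=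
  (enorm y)^-1 *: y.

Definition vec_of_seq (R : realType) (n : nat) (s : seq R) : 'rV[R]_n :=
  \row_(i < n) nth 0 s i.

(* Iterated one-dimensional Lebesgue integrals: the Lebesgue integral over
   R^n (by Fubini, for the bounded, compactly supported, Borel integrands
   used below). *)
Fixpoint iter_int (R : realType) (n : nat) (F : seq R -> R) : R :=
  match n with
  | 0 => F [::]
  | n'.+1 => Rintegral (@lebesgue_measure R) setT
               (fun t => iter_int n' (fun s => F (t :: s)))
  end.

Definition leb_int (R : realType) (n : nat) (F : 'rV[R]_n -> R) : R :=
  iter_int n (fun s => F (vec_of_seq n s)).

(* Integral of a function F (defined on S) against the normalized surface
   measure lambda of S, realised as the normalized cone measure:
   lambda(A) = vol{t a : a in A, 0 <= t <= 1} / vol(unit ball). *)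
Definition sph_int (R : realType) (n : nat) (F : 'rV[R]_n -> R) : R :=
  leb_int (fun y => if enorm y <= 1 then F (radial y) else 0) /
  leb_int (fun y : 'rV[R]_n => if enorm y <= 1 then 1 else 0).

Definition mu_inner (R : realType) (n : nat) (f u v : 'rV[R]_n -> R) : R :=
  sph_int (fun y => u y * v y * f y).

Definition poly_fun (R : realType) (n d : nat) (p : 'rV[R]_n -> R) : Prop :=
  exists c : {ffun {ffun 'I_n -> 'I_d.+1} -> R},
    forall x : 'rV[R]_n,
      p x = \sum_(a : {ffun 'I_n -> 'I_d.+1} | (\sum_(i < n) (a i : nat) <= d)%N)
              c a * \prod_(i < n) x 0 i ^+ a i.

Definition is_proj (R : realType) (n d : nat) (f h p : 'rV[R]_n -> R) : Prop :=
  poly_fun d p /\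
  forall q, poly_fun d q -> mu_inner f (fun y => h y - p y) q = 0.

Definition phi (R : realType) (n : nat) (x : 'rV[R]_n) (k : nat) (y : 'rV[R]_n) : R :=
  ((dotv x y + 1) / 2) ^+ k.

Definition kdeg (R : realType) (d : nat) : nat := Num.truncn ((d%:R : R) `^ (4 / 3)).

(* hat g_d(x) computed from a given projection p = Pi_d h_{x,k}. *)
Definition ghat (R : realType) (n : nat) (f p : 'rV[R]_n -> R) (x : 'rV[R]_n) (k : nat) : R :=
  mu_inner f p p / sph_int (fun y => phi x k y ^+ 2).

Definition hom_ext (R : realType) (n : nat) (g : 'rV[R]_n -> R) (y : 'rV[R]_n) : R :=
  g (radial y).

Definition C1_sphere (R : realType) (n : nat) (g : 'rV[R]_n -> R) (L : R) : Prop :=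
  let G := hom_ext g in
  (forall y : 'rV[R]_n, y != 0 -> forall i : 'I_n,
     derivable G y 'e_i /\ {for y, continuous (fun z => 'D_'e_i G z)}) /\
  (forall y i, @sphere R n y -> `|'D_'e_i G y| <= L).

Definition C2_sphere (R : realType) (n : nat) (g : 'rV[R]_n -> R) (L1 L2 : R) : Prop :=
  let G := hom_ext g in
  C1_sphere g L1 /\
  (forall y : 'rV[R]_n, y != 0 -> forall i j : 'I_n,
     derivable (fun z => 'D_'e_i G z) y 'e_j /\
     {for y, continuous (fun z => 'D_'e_j (fun w => 'D_'e_i G w) z)}) /\
  (forall y i j, @sphere R n y -> `|'D_'e_j (fun w => 'D_'e_i G w) y| <= L2).

Definition density_ok (R : realType) (n : nat) (f : 'rV[R]_n -> R) (m M : R) : Prop :=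
  (forall y, @sphere R n y -> m <= f y <= M) /\ sph_int f = 1.

(* Main.v *)
(** The squared projection splits as ||h||^2 - ||h - Pi_d h||^2, where ||h||^2 in L^2(mu) is the average of
    g against phi^2.  The kernel phi^2 = ((1 + <x, y>) / 2)^(2k) is concentrated at scale k^(-1/2) around x:
    rotation invariance of the surface measure, differentiated along rotations, gives the identities
    int phi^2 (y - <x, y> x) = 0 and 2k int phi^2 (1 - <x, y>) = (n - 1) int phi^2 <x, y>, so that averaging
    g costs O(k^(-1/2)) when g is C^1 and O(k^(-1)) when g is C^2, since the first-order term integrates to
    O(k^(-1)).  For the projection error no approximation theorem for g is needed: as phi is concentrated,
    h = phi g is within relative L^2 distance O(k^(-1/2)) of g(x) phi already, and phi, of degree k >= d, is
    approximated up to a superpolynomially small error by truncating its Chebyshev expansion at degree d,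
    because d is much larger than k^(1/2). *)
Require Import Defs.
From HB Require Import structures.
From mathcomp Require Import all_boot all_order all_algebra.
From mathcomp Require Import all_classical all_reals all_analysis.
From mathcomp Require Import measurable_realfun ring lra.
Import Order.TTheory GRing.Theory Num.Theory numFieldNormedType.Exports.
Set Implicit Arguments.
Unset Strict Implicit.
Unset Printing Implicit Defensive.
Local Open Scope ring_scope.
Local Open Scope classical_set_scope.

(** * Iterated Lebesgue integrals *)

Section iterated_integral.
Variable R : realType.
Local Notation mu := (@lebesgue_measure R).
Implicit Types (A K : R).

(** The integral is an iterated one-dimensional Lebesgue integral, on which rotations do not act
    visibly; what it allows directly is translating one variable and exchanging two adjacent
    integrals. A plane rotation is therefore written as a product of three shears, each of which
    translates one coordinate while the others are fixed. The price is to keep track of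
    measurability, boundedness and support under every shear. All scales are powers of r = d^(1/3):
    d = r^3, k lies between r^4/2 and r^4, and the two target rates are r^-2 and r^-4. The Chebyshev
    tail is estimated with a = 1 + r^-2: then k (a - 1)^2 stays bounded whereas a^-d is at most
    exp(-r/2). Such a tail is negligible against the mass of the kernel as soon as this mass is
    bounded below by some power of 1/k. The projection enters only through the square of its error,
    so a relative error of order k^(-1/2) contributes order r^-4, and the Lipschitz bound on g
    serves both rates there. *)

Lemma Rintegral_translate (h : R -> R) (b : R) :
  measurable_fun setT h -> mu.-integrable setT (EFin \o h) ->
  mu.-integrable setT (EFin \o (fun t => h (t + b))) ->
  \int[mu]_t h (t + b) = \int[mu]_t h t.
Proof.
move=> mh ih ihb; rewrite /Rintegral; congr fine.
pose phi : measurableTypeR R -> measurableTypeR R := fun t => t + b.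
have mphi : measurable_fun setT phi by apply: measurable_funD.
have := @integral_pushforward _ _ _ _ R phi mphi mu setT (EFin \o h).
rewrite preimage_setT => /(_ _ _ measurableT) <-//; last exact/measurable_EFinP.
apply: eq_measure_integral => X mX _.
(* Uniqueness of Lebesgue measure: the image of [mu] under the translation agrees with [mu] on
   half-open intervals. *)
apply/esym; apply: (lebesgue_measure_unique (mu := pushforward mu phi)) => // _ [[c d]] _ <-.
rewrite /pushforward/=.
transitivity (mu `]c - b, d - b]%classic); last first.
  congr (mu _); apply/seteqP; split => t /=; rewrite !in_itv/= ltrBlDr lerBrDr//.
rewrite !lebesgue_measure_itv/= !lte_fin ltrD2r; case: ifP => // _.
by rewrite -!EFinD; congr EFin; ring.
Qed.

Lemma bounded_supp_integrable A K (h : R -> R) : measurable_fun setT h ->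
  (forall t, `|h t| <= K) -> (forall t, A < `|t| -> h t = 0) ->
  mu.-integrable setT (EFin \o h).
Proof.
move=> mh hK hA.
have E : (EFin \o h) = ((EFin \o h) \_ `[- A, A]).
  apply/funext => t; rewrite /patch; case: ifPn => //= /negP tA.
  rewrite hA// ltNge; apply/negP => tA'; apply: tA.
  by rewrite inE/= in_itv/= -ler_norml.
rewrite E -integrable_mkcond //.
apply: measurable_bounded_integrable => //.
- by rewrite [X in (X < _)%E]lebesgue_measure_itv/=; case: ifP => // _; rewrite -EFinD ltry.
- exact: measurable_funTS.
- by exists K; split; rewrite ?num_real// => M KM t _; exact: le_trans (hK t) (ltW KM).
Qed.

Lemma Rintegral_bounded_supp A K (h : R -> R) : 0 <= A -> measurable_fun setT h ->
  (forall t, `|h t| <= K) -> (forall t, A < `|t| -> h t = 0) ->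
  `|\int[mu]_t h t| <= 2 * A * K.
Proof.
move=> A0 mh hK hA.
have ih := bounded_supp_integrable mh hK hA.
apply: (le_trans (le_normr_Rintegral _ ih)) => //.
have -> : \int[mu]_t `|h t| = \int[mu]_(t in `[- A, A]) `|h t|.
  rewrite [RHS]Rintegral_mkcond; apply: eq_Rintegral => t _; rewrite /patch.
  case: ifPn => //= /negP tA.
  rewrite hA ?normr0// ltNge; apply/negP => tA'; apply: tA.
  by rewrite inE/= in_itv/= -ler_norml.
have mA : mu `[- A, A]%classic = (2 * A)%:E.
  rewrite [LHS]lebesgue_measure_itv/= lte_fin; case: ltP => AA.
    by rewrite -EFinD; congr EFin; ring.
  by congr EFin; lra.
apply: (@le_trans _ _ (\int[mu]_(t in `[- A, A]) K)).
  apply: le_Rintegral => //.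
  - apply: (integrableS measurableT) => //.
    by apply: (bounded_supp_integrable (A:=A) (K:=K)) => [|t|t /hA ->];
      rewrite ?normr_id ?normr0//; exact: measurableT_comp.
  - apply: measurable_bounded_integrable => //; first by rewrite [X in (X < _)%E]mA ltry.
    by exists `|K|; split; rewrite ?num_real// => M KM t _ /=; apply/ltW.
by rewrite Rintegral_cst// [X in fine X]mA/= mulrC.
Qed.

(** Tonelli gives measurability for nonnegative integrands; the signed integral is the difference of
    those of the positive and negative parts. *)
Lemma measurable_Rintegral_param d (Z : measurableType d) (h : Z * R -> R) :
  measurable_fun setT h -> measurable_fun setT (fun z => \int[mu]_t h (z, t)).
Proof.
move=> mh.
rewrite /Rintegral; apply: (@measurableT_comp _ _ _ _ _ _ fine) => //.
under eq_fun do rewrite integralE.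
apply: emeasurable_funB.
- have mp : measurable_fun setT (EFin \o h)^\+%E.
    by apply: measurable_funepos; exact/measurable_EFinP.
  have H := @measurable_fun_fubini_tonelli_F _ _ Z (measurableTypeR R) R mu _ mp.
  have {}H := H (fun x => funepos_ge0 _ x).
  rewrite [X in measurable_fun _ X](_ : _ = fubini_F mu (EFin \o h)^\+%E)//.
  by apply/funext => z; apply: eq_integral => t _; rewrite !funeposE.
- have mp : measurable_fun setT (EFin \o h)^\-%E.
    by apply: measurable_funeneg; exact/measurable_EFinP.
  have H := @measurable_fun_fubini_tonelli_F _ _ Z (measurableTypeR R) R mu _ mp.
  have {}H := H (fun x => funeneg_ge0 _ x).
  rewrite [X in measurable_fun _ X](_ : _ = fubini_F mu (EFin \o h)^\-%E)//.
  by apply/funext => z; apply: eq_integral => t _; rewrite !funenegE.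
Qed.

(** The two support conditions confine [h] to a square of side 2A, where the bound [K] yields the
    absolute integrability required by Fubini. *)
Lemma Rintegral_swap A K (h : R * R -> R) : 0 <= A -> measurable_fun setT h ->
  (forall z, `|h z| <= K) -> (forall t s, A < `|t| -> h (t, s) = 0) ->
  (forall t s, A < `|s| -> h (t, s) = 0) ->
  \int[mu]_t (\int[mu]_s h (t, s)) = \int[mu]_s (\int[mu]_t h (t, s)).
Proof.
move=> A0 mh hK h1 h2.
have m1 t : measurable_fun setT (fun s => h (t, s)) by exact: measurable_fun_pair2.
have m2 s : measurable_fun setT (fun t => h (t, s)) by exact: measurable_fun_pair1.
have i1 t : mu.-integrable setT (fun s => (h (t, s))%:E).
  apply: (@bounded_supp_integrable A K) => [|u|u]; [exact: m1|exact: hK|exact: h2].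
have i2 s : mu.-integrable setT (fun t => (h (t, s))%:E).
  by apply: (@bounded_supp_integrable A K) => [|u|u]; [exact: m2|exact: hK|exact: h1].
rewrite /Rintegral; congr fine.
under eq_integral do rewrite fineK ?integrable_fin_num//.
under [RHS]eq_integral do rewrite fineK ?integrable_fin_num//.
apply: (@Fubini _ _ (measurableTypeR R) (measurableTypeR R) R mu mu (EFin \o h)).
apply/integrable12ltyP; first exact/measurable_EFinP.
have mn : measurable_fun setT (fun z => `|h z|) by exact: measurableT_comp.
have mn1 t : measurable_fun setT (fun s => `|h (t, s)|) by exact: measurableT_comp.
have ib t : mu.-integrable setT (fun s => (`|h (t, s)|)%:E).
  by apply: (@bounded_supp_integrable A K) => // [s|s /h2 ->]; rewrite ?normr_id ?normr0.
have := @measurable_Rintegral_param _ (measurableTypeR R) (fun z => `|h z|) mn.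
move=> mI.
have iI : mu.-integrable setT (EFin \o (fun t => \int[mu]_s `|h (t, s)|)).
  apply: (@bounded_supp_integrable A (2 * A * K)) => // t.
    by apply: (@Rintegral_bounded_supp A K) => // [s|s /h2 ->]; rewrite ?normr_id ?normr0.
  move=> tA; under eq_Rintegral do rewrite h1// normr0.
  by rewrite Rintegral_cst// mul0r.
case/integrableP: iI => _; apply: le_lt_trans.
apply: ge0_le_integral => //.
- by move=> t _; exact: integral_ge0.
- apply: (@measurable_fun_fubini_tonelli_F _ _ (measurableTypeR R) (measurableTypeR R) R mu (fun z => `|h z|%:E)) => //.
  exact/measurable_EFinP.
- by do 2 apply: measurableT_comp => //; exact/measurable_EFinP.
- move=> t _ /=; rewrite /Rintegral.
  rewrite -[X in (X <= _)%E]fineK; last by exact: integrable_fin_num.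
  by rewrite lee_fin ler_norm.
Qed.

End iterated_integral.

(** * Bounded, compactly supported integrands depending on a parameter *)

Section nice.
Variable R : realType.
Local Notation mu := (@lebesgue_measure R).
Implicit Types (A K : R) (n : nat).

(* The parameter space [Z] holds the variables that are not integrated: peeling off the head variable
   moves it into [Z], which makes every statement below provable by induction on [n]. *)
Record nice d (Z : measurableType d) n A K (F : Z -> seq R -> R) : Prop := Nice {
  nice_meas : measurable_fun setT (fun zs : Z * n.-tuple R => F zs.1 zs.2);
  nice_bound : forall z s, size s = n -> `|F z s| <= K;
  nice_supp : forall z s, size s = n -> has (fun t => A < `|t|) s -> F z s = 0 }.

Lemma iter_int_ext n (F G : seq R -> R) :
  (forall s, size s = n -> F s = G s) -> iter_int n F = iter_int n G.
Proof.
elim: n F G => [|n IH] F G FG /=; first exact: FG.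
by apply: eq_Rintegral => t _; apply: IH => s sn; apply: FG; rewrite /= sn.
Qed.

Lemma iter_int0 n : iter_int n (fun=> 0 : R) = 0.
Proof.
elim: n => [//|n IH] /=.
by under eq_Rintegral do rewrite IH; rewrite Rintegral_cst// mul0r.
Qed.

(** Common form of the substitutions used below: turning the head variable into a parameter,
    reordering variables, shearing. The last hypothesis says that a point outside the new cube is
    sent outside the old one. *)
Lemma nice_precomp d d' (Z : measurableType d) (Z' : measurableType d') n n' A A' K
    (F : Z -> seq R -> R) (p : Z' -> seq R -> Z) (q : Z' -> seq R -> seq R) :
  nice n A K F ->
  measurable_fun setT (fun zs : Z' * n'.-tuple R => p zs.1 zs.2) ->
  (forall z s, size s = n' -> size (q z s) = n) ->
  (forall i, (i < n)%N -> measurable_fun setT (fun zs : Z' * n'.-tuple R => nth 0 (q zs.1 zs.2) i)) ->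
  (forall z s, size s = n' -> has (fun t => A' < `|t|) s -> has (fun t => A < `|t|) (q z s)) ->
  nice n' A' K (fun z s => F (p z s) (q z s)).
Proof.
move=> [mF bF sF] mp sq mq hq; split.
- have hs (zs : Z' * n'.-tuple R) : size (q zs.1 zs.2) == n.
    by apply/eqP; apply: sq; rewrite size_tuple.
  pose Q zs : n.-tuple R := Tuple (hs zs).
  apply: (@measurableT_comp _ _ _ _ _ _ (fun zs : Z * n.-tuple R => F zs.1 zs.2) _
     (fun zs : Z' * n'.-tuple R => (p zs.1 zs.2, Q zs))) => //.
  apply/measurable_fun_pairP; split => //.
  apply/measurable_fun_tnthP => i.
  rewrite (_ : _ \o _ = (fun zs : Z' * n'.-tuple R => nth 0 (q zs.1 zs.2) i)).
    exact: mq.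
  by apply/funext => zs /=; rewrite (tnth_nth 0).
- by move=> z s sn; apply: bF; exact: sq.
- by move=> z s sn /(hq z s sn); apply: sF; exact: sq.
Qed.

Lemma measurable_nth_tuple d (Z : measurableType d) n i :
  measurable_fun setT (fun zs : Z * n.-tuple R => nth 0 zs.2 i).
Proof.
have [ni|ni] := ltnP i n.
  rewrite (_ : (fun _ => _) = (fun s : n.-tuple R => tnth s (Ordinal ni)) \o snd).
    by apply: measurableT_comp => //; exact: measurable_tnth.
  by apply/funext => zs /=; rewrite (tnth_nth 0).
rewrite (_ : (fun _ => _) = (fun=> 0)); first exact: measurable_cst.
by apply/funext => zs; rewrite nth_default// size_tuple.
Qed.

Lemma nice_cons d (Z : measurableType d) n A K (F : Z -> seq R -> R) :
  nice n.+1 A K F -> nice n A K (fun (zt : Z * R) s => F zt.1 (zt.2 :: s)).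
Proof.
move=> nF.
apply: (nice_precomp (p := fun zt s => zt.1) (q := fun zt s => zt.2 :: s) nF).
- exact: (measurableT_comp measurable_fst).
- by move=> z s /= ->.
- move=> [|i] ni /=; first exact: (measurableT_comp measurable_snd).
  exact: measurable_nth_tuple.
- by move=> z s _ h; apply/orP; right.
Qed.

Lemma iter_int_head_supp d (Z : measurableType d) n A K (F : Z -> seq R -> R) z t :
  nice n.+1 A K F -> A < `|t| -> iter_int n (fun s => F z (t :: s)) = 0.
Proof.
move=> nF tA; rewrite -[RHS](iter_int0 n); apply: iter_int_ext => s sn.
by apply: (nice_supp nF); rewrite /= ?sn// tA.
Qed.

Lemma iter_int_measurable d (Z : measurableType d) n A K (F : Z -> seq R -> R) :
  0 <= A -> nice n A K F ->
  measurable_fun setT (fun z => iter_int n (F z)) /\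
  forall z, `|iter_int n (F z)| <= (2 * A) ^+ n * K.
Proof.
move=> A0; elim: n d Z F => [|n IH] d Z F nF /=.
  split; last by move=> z; rewrite mul1r; exact: (nice_bound nF).
  apply: (@measurableT_comp _ _ _ _ _ _ (fun zs : Z * 0.-tuple R => F zs.1 zs.2) _
     (fun z => (z, [tuple]))) => //; exact: (nice_meas nF).
have [mI bI] := IH _ _ _ (nice_cons nF).
split.
  exact: (@measurable_Rintegral_param _ _ Z (fun zt => iter_int n (fun s => F zt.1 (zt.2 :: s)))).
move=> z; rewrite exprS -mulrA; apply: Rintegral_bounded_supp => //.
- exact: (@measurable_fun_pair2 _ _ _ _ _ _ (fun zt : Z * R => iter_int n (fun s => F zt.1 (zt.2 :: s)))).
- by move=> t; exact: (bI (z, t)).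
- by move=> t; exact: iter_int_head_supp nF.
Qed.

Lemma iter_int_integrable d (Z : measurableType d) n A K (F : Z -> seq R -> R) z :
  0 <= A -> nice n.+1 A K F ->
  mu.-integrable setT (EFin \o (fun t => iter_int n (fun s => F z (t :: s)))).
Proof.
move=> A0 nF; have [mI bI] := iter_int_measurable A0 (nice_cons nF).
apply: (@bounded_supp_integrable _ A ((2 * A) ^+ n * K)).
- exact: (@measurable_fun_pair2 _ _ _ _ _ _ (fun zt : Z * R => iter_int n (fun s => F zt.1 (zt.2 :: s)))).
- by move=> t; exact: (bI (z, t)).
- by move=> t; exact: iter_int_head_supp nF.
Qed.

Lemma iter_intD d (Z : measurableType d) n A A' K K' (F G : Z -> seq R -> R) z :
  0 <= A -> 0 <= A' -> nice n A K F -> nice n A' K' G ->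
  iter_int n (fun s => F z s + G z s) = iter_int n (F z) + iter_int n (G z).
Proof.
move=> A0 A'0; elim: n d Z F G z => [|n IH] d Z F G z nF nG //=.
rewrite -RintegralD//; [|exact: iter_int_integrable nF|exact: iter_int_integrable nG].
apply: eq_Rintegral => t _.
have H z' := IH _ _ _ _ z' (nice_cons nF) (nice_cons nG); exact: (H (z, t)).
Qed.

Lemma iter_intZ d (Z : measurableType d) n A K c (F : Z -> seq R -> R) z :
  0 <= A -> nice n A K F ->
  iter_int n (fun s => c * F z s) = c * iter_int n (F z).
Proof.
move=> A0; elim: n d Z F z => [|n IH] d Z F z nF //=.
rewrite -RintegralZl//; last exact: iter_int_integrable nF.
have H z' := IH _ _ _ z' (nice_cons nF).
by apply: eq_Rintegral => t _; exact: (H (z, t)).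
Qed.

Lemma le_iter_int d (Z : measurableType d) n A A' K K' (F G : Z -> seq R -> R) z :
  0 <= A -> 0 <= A' -> nice n A K F -> nice n A' K' G ->
  (forall z s, size s = n -> F z s <= G z s) ->
  iter_int n (F z) <= iter_int n (G z).
Proof.
move=> A0 A'0; elim: n d Z F G z => [|n IH] d Z F G z nF nG FG /=; first exact: FG.
apply: le_Rintegral => //; [exact: iter_int_integrable nF|exact: iter_int_integrable nG|].
have H z' := IH _ _ _ _ z' (nice_cons nF) (nice_cons nG).
move=> t _; apply: (H (z, t)).
by move=> zt s sn; apply: FG; rewrite /= sn.
Qed.

(** The outermost integral travels to the innermost place by n adjacent exchanges. There all other
    variables are fixed, so that shifting the head by a function of them is a translation. *)
Lemma iter_int_head_last d (Z : measurableType d) n A K (F : Z -> seq R -> R) z :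
  0 <= A -> nice n.+1 A K F ->
  iter_int n.+1 (F z) = iter_int n (fun s => \int[mu]_t F z (t :: s)).
Proof.
move=> A0; elim: n d Z F z => [//|n IH] d Z F z nF.
pose h (ts : R * R) := iter_int n (fun s => F z (ts.1 :: ts.2 :: s)).
have nF1 := nice_cons nF; have nF2 := nice_cons nF1.
have [mI bI] := iter_int_measurable A0 nF2.
have mh : measurable_fun setT h.
  apply: (@measurableT_comp _ _ _ _ _ _ (fun z : Z * R * R => iter_int n (fun s => F z.1.1 (z.1.2 :: z.2 :: s))) _ (fun ts : R * R => ((z, ts.1), ts.2))) => //.
  by do 2 (apply: measurable_fun_pair => //).
transitivity (\int[mu]_t \int[mu]_s h (t, s)); first by [].
rewrite (@Rintegral_swap _ A ((2 * A) ^+ n * K))//; first last.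
- move=> t s sA; rewrite /h -[RHS](iter_int0 n); apply: iter_int_ext => u un.
  by apply: (nice_supp nF); rewrite /= ?un// sA orbT.
- move=> t s tA; rewrite /h -[RHS](iter_int0 n); apply: iter_int_ext => u un.
  by apply: (nice_supp nF); rewrite /= ?un// tA.
- by move=> [t s]; exact: (bI ((z, t), s)).
rewrite /=; apply: eq_Rintegral => s _.
(* After the exchange [s] becomes a parameter, and [t] must again be the head for the induction
   hypothesis; [F'] puts [s] back behind the head. The default of [head] is never met, as [u] has
   n+1 entries. *)
pose F' (zs : Z * R) (u : seq R) := F zs.1 (head 0 u :: zs.2 :: behead u).
have nF' : nice n.+1 A K F'.
  apply: (nice_precomp (p := fun zt s => zt.1)
     (q := fun (zs : Z * R) (u : seq R) => head 0 u :: zs.2 :: behead u) nF).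
  - exact: (measurableT_comp measurable_fst).
  - by move=> zs u; rewrite /= size_behead => ->.
  - move=> [|[|i]] ni /=.
    + rewrite (_ : (fun _ => _) = (fun zs : (Z * R) * n.+1.-tuple R => nth 0 zs.2 0%N)).
        exact: measurable_nth_tuple.
      by apply/funext => zs; rewrite nth0.
    + exact: (measurableT_comp measurable_snd).
    + rewrite (_ : (fun _ => _) = (fun zs : (Z * R) * n.+1.-tuple R => nth 0 zs.2 i.+1)).
        exact: measurable_nth_tuple.
      by apply/funext => zs; rewrite nth_behead.
  - by move=> [z' s'] [|u0 u] //= _ /orP[->//|->]; rewrite !orbT.
have H z' := IH _ _ F' z' nF'; exact: (H (z, s)).
Qed.

Definition trans i b (s : seq R) := set_nth 0 s i (nth 0 s i + b).
Definition shear i j a (s : seq R) := trans i (a * nth 0 s j) s.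

Lemma size_trans i b s : (i < size s)%N -> size (trans i b s) = size s.
Proof. by move=> si; rewrite /trans size_set_nth; apply/maxn_idPr. Qed.

Lemma nth_trans i b s k : nth 0 (trans i b s) k = nth 0 s k + (if k == i then b else 0).
Proof.
by rewrite /trans nth_set_nth/=; case: eqP => [->//|_]; rewrite addr0.
Qed.

(** Why the radius grows by 1 + |a|: if the sheared sequence lies in the cube of radius A, then
    coordinate j, which is unchanged, is at most A in absolute value, and undoing the shear moves
    coordinate i by at most |a| A. *)
Lemma nice_shear d (Z : measurableType d) n A K (F : Z -> seq R -> R) i j a :
  0 <= A -> (i < n)%N -> (j < n)%N -> i != j -> nice n A K F ->
  nice n (A * (1 + `|a|)) K (fun z s => F z (shear i j a s)).
Proof.
move=> A0 ni nj ij nF.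
apply: (nice_precomp (p := fun z s => z) (q := fun z s => shear i j a s) nF).
- exact: measurable_fst.
- by move=> _ s sn; rewrite size_trans sn.
- move=> k kn; under eq_fun do rewrite nth_trans.
  case: (k == i); last by apply: measurable_funD => //; exact: measurable_nth_tuple.
  apply: measurable_funD; first exact: measurable_nth_tuple.
  by apply: measurable_funM => //; exact: measurable_nth_tuple.
- move=> _ s sn /(has_nthP 0)[k ks hk].
  apply/(has_nthP 0).
  have A1 : A <= A * (1 + `|a|) by rewrite ler_peMr// lerDl.
  have ss : size (shear i j a s) = n by rewrite size_trans ?sn.
  have [kE|ki] := eqVneq k i; last first.
    exists k; first by rewrite ss -sn.
    by rewrite nth_trans (negbTE ki) addr0; exact: le_lt_trans hk.
  have [js|js] := ltP A `|nth 0 s j|.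
    exists j; rewrite ?ss// nth_trans eq_sym (negbTE ij) addr0//.
  exists i; rewrite ?ss// nth_trans eqxx; subst k.
  have : `|a * nth 0 s j| <= `|a| * A by rewrite normrM ler_wpM2l.
  have := ler_normB (nth 0 s i + a * nth 0 s j) (a * nth 0 s j).
  rewrite addrK => h1 h2; rewrite ltNge; apply/negP => h3.
  move: hk; apply/negP; rewrite -leNgt mulrDr mulr1 (mulrC A).
  by apply: (le_trans h1); rewrite lerD.
Qed.

Lemma iter_int_trans d (Z : measurableType d) n A K (F : Z -> seq R -> R) i b z :
  0 <= A -> (i < n)%N -> nice n A K F ->
  iter_int n (fun s => F z (trans i b s)) = iter_int n (F z).
Proof.
move=> A0; elim: n d Z F i z => [//|n IH] d Z F [|i] z ni nF /=.
  have [mI bI] := iter_int_measurable A0 (nice_cons nF).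
  have mI' : measurable_fun setT (fun t => iter_int n (fun s => F z (t :: s))).
    exact: (@measurable_fun_pair2 _ _ _ _ _ _ (fun zt : Z * R => iter_int n (fun s => F zt.1 (zt.2 :: s)))).
  apply: (@Rintegral_translate _ (fun t => iter_int n (fun s => F z (t :: s)))) => //.
    exact: iter_int_integrable nF.
  apply: (@bounded_supp_integrable _ (A + `|b|) ((2 * A) ^+ n * K)).
  - have mt : measurable_fun setT (fun t : R => t + b) by apply: measurable_funD.
    exact: (measurableT_comp mI' mt).
  - by move=> t; exact: (bI (z, t + b)).
  - move=> t tA; apply: (iter_int_head_supp _ nF).
    have := ler_normB (t + b) b; rewrite addrK; lra.
apply: eq_Rintegral => t _.
have H z' := IH _ _ _ i z' ni (nice_cons nF); exact: (H (z, t)).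
Qed.

(** If i is the head, its shift depends on an inner variable, so its integral is first moved
    innermost, where the shift is a constant. If j is the head, the shift is constant for all inner
    integrals. Otherwise the head becomes a parameter. *)
Lemma iter_int_shear d (Z : measurableType d) n A K (F : Z -> seq R -> R) i j a z :
  0 <= A -> (i < n)%N -> (j < n)%N -> i != j -> nice n A K F ->
  iter_int n (fun s => F z (shear i j a s)) = iter_int n (F z).
Proof.
move=> A0; elim: n d Z F i j z => [//|n IH] d Z F [|i] [|j] z ni nj ij nF //.
- have nS := nice_shear a A0 ni nj ij nF.
  have A'0 : 0 <= A * (1 + `|a|) by rewrite mulr_ge0// addr_ge0.
  rewrite (iter_int_head_last z A'0 nS) (iter_int_head_last z A0 nF).
  apply: iter_int_ext => s sn; rewrite /shear /trans /=.
  have m1 : measurable_fun setT (fun t => F z (t :: s)).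
    have sn' : size s == n by apply/eqP.
    apply: (@measurableT_comp _ _ _ _ _ _ (fun zs : Z * n.+1.-tuple R => F zs.1 zs.2) _
     (fun t : R => (z, [tuple of t :: Tuple sn']))) => //; first exact: (nice_meas nF).
    apply: measurable_fun_pair => //; exact: (@measurable_cons _ _ _ _ id n (fun=> Tuple sn')).
  have b1 t : `|F z (t :: s)| <= K by apply: (nice_bound nF); rewrite /= sn.
  have s1 t : A < `|t| -> F z (t :: s) = 0.
    by move=> tA; apply: (nice_supp nF); rewrite /= ?sn// tA.
  apply: (@Rintegral_translate _ (fun t => F z (t :: s))) => //.
    exact: bounded_supp_integrable s1.
  set c := a * _.
  apply: (@bounded_supp_integrable _ (A + `|c|) K) => //.
  - have mt : measurable_fun setT (fun t : R => t + c) by apply: measurable_funD.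
    exact: (measurableT_comp m1 mt).
  - move=> t tA; apply: s1.
    have := ler_normB (t + c) c; rewrite addrK; lra.
- rewrite /=; apply: eq_Rintegral => t _.
  have H z' := iter_int_trans (a * t) z' A0 (ni : (i < n)%N) (nice_cons nF); exact: (H (z, t)).
- rewrite /=; apply: eq_Rintegral => t _.
  have H z' := IH _ _ _ i j z' (ni : (i < n)%N) (nj : (j < n)%N) ij (nice_cons nF); exact: (H (z, t)).
Qed.

End nice.

(** * Vectors and the Euclidean norm *)

Section vectors.
Variables (R : realType) (n : nat).
Implicit Types (x y z : 'rV[R]_n) (a c : R).

Lemma dotvZl a x y : dotv (a *: x) y = a * dotv x y.
Proof. by rewrite /dotv mulr_sumr; apply: eq_bigr => i _; rewrite mxE mulrA. Qed.

Lemma dotvC x y : dotv x y = dotv y x.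
Proof. by rewrite /dotv; apply: eq_bigr => i _; rewrite mulrC. Qed.

Lemma dotvZr a x y : dotv x (a *: y) = a * dotv x y.
Proof. by rewrite dotvC dotvZl dotvC. Qed.

Lemma dotvDl x y z : dotv (x + y) z = dotv x z + dotv y z.
Proof.
by rewrite /dotv -big_split; apply: eq_bigr => i _; rewrite mxE mulrDl.
Qed.

Lemma dotvDr x y z : dotv x (y + z) = dotv x y + dotv x z.
Proof. by rewrite dotvC dotvDl !(dotvC _ x). Qed.

Lemma dotvNl x y : dotv (- x) y = - dotv x y.
Proof. by rewrite -scaleN1r dotvZl mulN1r. Qed.

Lemma dotvNr x y : dotv x (- y) = - dotv x y.
Proof. by rewrite dotvC dotvNl dotvC. Qed.

Lemma dotv_ge0 x : 0 <= dotv x x.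
Proof. by rewrite /dotv; apply: sumr_ge0 => i _; rewrite -expr2 sqr_ge0. Qed.

Lemma sqr_coord_le_dotv x i : x 0 i ^+ 2 <= dotv x x.
Proof.
rewrite /dotv (bigD1 i)//= -expr2 lerDl.
by apply: sumr_ge0 => j _; rewrite -expr2 sqr_ge0.
Qed.

Lemma dotv_eq0 x : (dotv x x == 0) = (x == 0).
Proof.
apply/eqP/eqP => [x0|->]; last by rewrite /dotv big1// => i _; rewrite mxE mul0r.
apply/rowP => i; rewrite mxE; apply/eqP; rewrite -sqrf_eq0 eq_le sqr_ge0 andbT.
by rewrite -x0 sqr_coord_le_dotv.
Qed.

Lemma dotv_gt0 x : (0 < dotv x x) = (x != 0).
Proof. by rewrite lt_neqAle dotv_ge0 andbT eq_sym dotv_eq0. Qed.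

Lemma enorm_ge0 x : 0 <= enorm x.
Proof. exact: sqrtr_ge0. Qed.

Lemma sqr_enorm x : enorm x ^+ 2 = dotv x x.
Proof. by rewrite sqr_sqrtr// dotv_ge0. Qed.

Lemma enorm_gt0 x : (0 < enorm x) = (x != 0).
Proof. by rewrite sqrtr_gt0 dotv_gt0. Qed.

Lemma enorm_le1 x : (enorm x <= 1) = (dotv x x <= 1).
Proof. by rewrite -[X in _ <= X]sqrtr1 ler_sqrt. Qed.

Lemma enormZ a x : enorm (a *: x) = `|a| * enorm x.
Proof. by rewrite /enorm dotvZl dotvZr mulrA -expr2 sqrtrM ?sqr_ge0// sqrtr_sqr. Qed.

Lemma dotv_radial x : x != 0 -> dotv (radial x) (radial x) = 1.
Proof.
move=> x0; rewrite dotvZl dotvZr -sqr_enorm mulrA -expr2 exprVn mulVf//.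
by rewrite expf_neq0// gt_eqF// enorm_gt0.
Qed.

Lemma radial0 : radial (0 : 'rV[R]_n) = 0.
Proof. by rewrite /radial scaler0. Qed.

Lemma sphere_neq0 x : dotv x x = 1 -> x != 0.
Proof. by move=> x1; rewrite -dotv_gt0 x1. Qed.

Lemma sphere_radial x : dotv x x = 1 -> radial x = x.
Proof. by move=> x1; rewrite /radial /enorm x1 sqrtr1 invr1 scale1r. Qed.

Lemma radialZ a x : 0 < a -> radial (a *: x) = radial x.
Proof.
move=> a0; rewrite /radial enormZ gtr0_norm// scalerA invfM mulrAC mulVf ?mul1r//.
by rewrite gt_eqF.
Qed.

Lemma coord_le_enorm x i : `|x 0 i| <= enorm x.
Proof.
by rewrite -(ger0_norm (enorm_ge0 x)) -ler_sqr ?nnegrE// !real_normK ?num_real// sqr_enorm sqr_coord_le_dotv.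
Qed.

Lemma coord_sphere_le1 x i : dotv x x = 1 -> `|x 0 i| <= 1.
Proof. by move=> x1; have := coord_le_enorm x i; rewrite /enorm x1 sqrtr1. Qed.

Lemma dotv_cauchy_schwarz x y : dotv x y ^+ 2 <= dotv x x * dotv y y.
Proof.
have [->|y0] := eqVneq y 0.
  by rewrite -(scale0r (0 : 'rV[R]_n)) !dotvZr !mul0r mulr0 expr0n.
have yy : 0 < dotv y y by rewrite dotv_gt0.
have := dotv_ge0 (dotv y y *: x - dotv x y *: y).
rewrite dotvDl !dotvDr !dotvNl !dotvNr !dotvZl !dotvZr (dotvC y x) => H.
rewrite -(ler_pM2r yy) -subr_ge0; apply: (le_trans H).
by rewrite le_eqVlt; apply/orP; left; apply/eqP; ring.
Qed.

Lemma dotv_le_enorm x y : dotv x y <= enorm x * enorm y.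
Proof.
apply: (le_trans (ler_norm _)).
rewrite -ler_sqr ?nnegrE ?mulr_ge0 ?enorm_ge0// real_normK ?num_real//.
by rewrite exprMn !sqr_enorm dotv_cauchy_schwarz.
Qed.

Lemma dotv_sphere_itv x y : dotv x x = 1 -> dotv y y = 1 -> -1 <= dotv x y <= 1.
Proof.
move=> x1 y1; rewrite -ler_norml -ler_sqr ?nnegrE//.
by rewrite real_normK ?num_real// (le_trans (dotv_cauchy_schwarz x y))// x1 y1 mulr1 expr1n.
Qed.

Lemma enormD x y : enorm (x + y) <= enorm x + enorm y.
Proof.
rewrite -ler_sqr ?nnegrE ?addr_ge0 ?enorm_ge0// sqrrD !sqr_enorm.
rewrite dotvDl !dotvDr (dotvC y x).
have := dotv_le_enorm x y; lra.
Qed.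

Lemma sqr_dist_sphere x y : dotv x x = 1 -> dotv y y = 1 ->
  dotv (y - x) (y - x) = 2 * (1 - dotv x y).
Proof.
move=> x1 y1; rewrite dotvDl !dotvDr !dotvNr !dotvNl x1 y1 (dotvC y x); ring.
Qed.

Lemma enorm_coord_bound x a : (forall i, `|x 0 i| <= a) -> enorm x <= n%:R * a.
Proof.
have [n0|n0] := posnP n.
  move=> _; suff x0 : dotv x x = 0 by rewrite /enorm x0 sqrtr0 n0 mul0r.
  apply/eqP; rewrite dotv_eq0; apply/eqP.
  by apply/rowP => i; have := ltn_ord i; rewrite [X in (_ < X)%N]n0.
move=> xa; have a0 : 0 <= a by exact: le_trans (xa (Ordinal n0)).
rewrite -ler_sqr ?nnegrE ?mulr_ge0 ?enorm_ge0// sqr_enorm exprMn.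
apply: (@le_trans _ _ (\sum_(i < n) a ^+ 2)).
  by apply: ler_sum => i _; rewrite -expr2 -real_normK ?num_real// ler_sqr ?nnegrE.
rewrite sumr_const card_ord -[_ *+ n]mulr_natl. rewrite ler_wpM2r  ?sqr_ge0//.
by rewrite -natrX ler_nat -{1}(expn1 n) leq_pexp2l.
Qed.

End vectors.

(** * Integrals over the sphere *)

Section step_functions.
Variables (R : realType) (n : nat).

Definition grid (k : nat) (y : 'rV[R]_n) : 'rV[R]_n :=
  \row_i ((Num.floor (k.+1%:R * y 0 i))%:~R / k.+1%:R).

Lemma grid_dist k (y : 'rV[R]_n) i : `|y 0 i - grid k y 0 i| <= k.+1%:R^-1.
Proof.
rewrite mxE; have /andP[h1 h2] := floor_itv (k.+1%:R * y 0 i).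
have k0 : 0 < k.+1%:R :> R by [].
rewrite -(ler_pM2l k0) mulfV ?gt_eqF//.
rewrite -{1}(gtr0_norm k0) -normrM mulrBr mulrCA mulfV ?gt_eqF// mulr1.
rewrite ger0_norm ?subr_ge0// lerBlDl.
by move: h2; rewrite intrD => /ltW.
Qed.

Lemma cvg_grid (y : 'rV[R]_n) : grid ^~ y @ \oo --> y.
Proof.
apply/cvgrPdist_lt => e e0; near=> k.
rewrite [X in X < _]/Num.norm/= mx_normrE.
apply: (@le_lt_trans _ _ k.+1%:R^-1); last by near: k; exact: near_infty_natSinv_lt (PosNum e0).
apply: bigmax_le => // -[i j] _ /=; rewrite ord1.
by rewrite mxE [X in _ + X]mxE; exact: grid_dist.
Unshelve. all: by end_near. Qed.

(** [H] is the pointwise limit of its values at points rounded to the grid of mesh 1/(k+1). Each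
    rounded function is constant on countably many measurable cells, hence measurable for the
    product structure on tuples. *)
Lemma measurable_row_continuous (H : 'rV[R]_n -> R) :
  (forall y, y != 0 -> {for y, continuous H}) ->
  measurable_fun setT (fun s : n.-tuple R => H (vec_of_seq n s)).
Proof.
move=> cH.
apply: (@measurable_fun_cvg _ _ _ _ (fun k (s : n.-tuple R) => H (grid k (vec_of_seq n s)))).
- move=> k _ B mB; rewrite setTI.
  pose pt (w : {ffun 'I_n -> int}) : 'rV[R]_n := \row_i ((w i)%:~R / k.+1%:R).
  pose cell (w : {ffun 'I_n -> int}) : set (n.-tuple R) :=
    if pselect (B (H (pt w))) then
    \bigcap_(i in @setT 'I_n) [set s : n.-tuple R | Num.floor (k.+1%:R * tnth s i) = w i] else set0.
  rewrite (_ : _ @^-1` _ = \bigcup_w cell w); last first.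
    apply/seteqP; split => s /=.
    + move=> Bs; exists [ffun i => Num.floor (k.+1%:R * tnth s i)] => //.
      rewrite /cell; set w := [ffun _ => _].
      have E : grid k (vec_of_seq n s) = pt w.
        by apply/rowP => i; rewrite !mxE ffunE (tnth_nth 0).
      rewrite -E; case: pselect => // _ i _ /=; by rewrite ffunE.
    + move=> [w _]; rewrite /cell; case: pselect => // Bw sw.
      rewrite (_ : grid k (vec_of_seq n s) = pt w)//.
      by apply/rowP => i; rewrite !mxE -(sw i)// (tnth_nth 0).
  apply: countable_bigcupT_measurable => // w; rewrite /cell.
  case: pselect => [?|?] /=; last exact: measurable0.
  apply: fin_bigcap_measurable => // i _.
  have mt : measurable_fun setT (fun s : n.-tuple R => k.+1%:R * tnth s i).
    by apply: measurable_funM => //; exact: measurable_tnth.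
  rewrite (_ : [set _ | _] = (fun s : n.-tuple R => k.+1%:R * tnth s i) @^-1` `[(w i)%:~R, (w i + 1)%:~R[%classic).
    by rewrite -[X in measurable X]setTI; exact: mt.
  apply/seteqP; split => s /=; rewrite in_itv/= -floor_eq; by move/eqP.
(* At the origin, where [H] may jump, rounding is exact and the approximants are constant. *)
- move=> s _; have [->|s0] := eqVneq (vec_of_seq n s) 0.
    rewrite (_ : (fun _ => _) = cst (H 0)); first exact: cvg_cst.
    apply/funext => k /=; congr H; apply/rowP => i.
    by rewrite !mxE mulr0 floor0 mul0r.
  apply: continuous_cvg; [exact: cH|exact: cvg_grid].
Qed.

End step_functions.

(** * Cone-measure integrals of functions on the sphere *)

Section ball_integral.
Variable R : realType.
Implicit Types n : nat.

Definition ballf n (F : 'rV[R]_n -> R) (y : 'rV[R]_n) : R :=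
  if enorm y <= 1 then F (radial y) else 0.

Definition ball_int n (F : 'rV[R]_n -> R) : R := leb_int (ballf F).

Lemma sph_intE n (F : 'rV[R]_n -> R) : sph_int F = ball_int F / ball_int (fun _ : 'rV[R]_n => 1).
Proof. by []. Qed.

(** Admissible integrands: the degree-0 homogeneous extension, cut off at the unit ball, is
    measurable and bounded. The radius is 1 because the ball lies in the cube of that radius; the
    parameter space is trivial. *)
Definition adm n (F : 'rV[R]_n -> R) : Prop :=
  exists K, nice n 1 K (fun (_ : unit) s => ballf F (vec_of_seq n s)).

Lemma vec_of_seq_coord n (s : seq R) i : vec_of_seq n s 0 i = nth 0 s i.
Proof. by rewrite mxE. Qed.

Lemma measurable_dotv_vec n :
  measurable_fun setT (fun zs : unit * n.-tuple R => dotv (vec_of_seq n zs.2) (vec_of_seq n zs.2)).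
Proof.
apply: measurable_sum => i; under eq_fun do rewrite vec_of_seq_coord.
by apply: measurable_funM; exact: measurable_nth_tuple.
Qed.

Lemma measurable_in_ball n :
  measurable_fun setT (fun zs : unit * n.-tuple R => enorm (vec_of_seq n zs.2) <= 1).
Proof.
under eq_fun do rewrite enorm_le1.
by apply: measurable_fun_ler => //; exact: measurable_dotv_vec.
Qed.

Lemma ballf_supp n (F : 'rV[R]_n -> R) (s : seq R) : size s = n ->
  has (fun t => 1 < `|t|) s -> ballf F (vec_of_seq n s) = 0.
Proof.
move=> sn /(has_nthP 0)[i si h]; rewrite /ballf; case: ifPn => // y1.
rewrite sn in si; have := coord_le_enorm (vec_of_seq n s) (Ordinal si).
by rewrite mxE /= => /(lt_le_trans h)/lt_le_trans/(_ y1); rewrite ltxx.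
Qed.

Lemma adm_nice_unit n (F : 'rV[R]_n -> R) K :
  measurable_fun setT (fun zs : unit * n.-tuple R => ballf F (vec_of_seq n zs.2)) ->
  (forall y, `|F (radial y)| <= K) -> adm F.
Proof.
move=> mF bF; exists K; split => //.
- move=> _ s _; rewrite /ballf; case: ifPn => // _.
  by rewrite normr0; exact: le_trans (bF 0).
- by move=> _ s; exact: ballf_supp.
Qed.

Lemma adm_continuous n (F : 'rV[R]_n -> R) K :
  (forall y, y != 0 -> {for y, continuous (fun z => F (radial z))}) ->
  (forall y, dotv y y = 1 -> `|F y| <= K) -> adm F.
Proof.
(* [radial 0] is 0, a point off the sphere, so [F 0] enters the bound separately. *)
move=> cF bF; apply: (@adm_nice_unit _ _ (Num.max K `|F 0|)).
- apply: measurable_fun_ifT => //; first exact: measurable_in_ball.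
  apply: (@measurableT_comp _ _ _ _ _ _ (fun s : n.-tuple R => F (radial (vec_of_seq n s))) _ snd) => //.
  exact: (measurable_row_continuous cF).
- move=> y; have [->|y0] := eqVneq y 0; first by rewrite radial0 le_max lexx orbT.
  by rewrite le_max bF// dotv_radial.
Qed.

Lemma continuous_enorm n (y : 'rV[R]_n) : {for y, continuous (@enorm R n)}.
Proof.
apply: (@continuous_comp _ _ _ (fun x : 'rV[R]_n => dotv x x) Num.sqrt); last exact: sqrt_continuous.
have c i : {for y, continuous (fun x : 'rV[R]_n => x 0 i)} by exact: coord_continuous.
rewrite /dotv; elim: (index_enum _) => [|i r IH].
  rewrite (_ : (fun _ => _) = cst (0 : R)); first exact: cst_continuous.
  by apply/funext => x; rewrite big_nil.
rewrite (_ : (fun _ => _) = (fun x : 'rV[R]_n => x 0 i * x 0 i) + (fun x => \sum_(j <- r) x 0 j * x 0 j)).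
  exact: (continuousD (continuousM (c i) (c i)) IH).
by apply/funext => x; rewrite big_cons.
Qed.

Lemma adm_coord n (i : 'I_n) : adm (fun y : 'rV[R]_n => y 0 i).
Proof.
apply: (@adm_continuous _ _ 1) => [y y0|y]; last exact: coord_sphere_le1.
rewrite (_ : (fun z => _) = (fun z => (enorm z)^-1 * z 0 i)).
  have c : {for y, continuous (fun x : 'rV[R]_n => x 0 i)} by exact: coord_continuous.
  have e0 : enorm y != 0 by rewrite gt_eqF// enorm_gt0.
  exact: (continuousM (continuousV e0 (@continuous_enorm _ y)) c).
by apply/funext => z; rewrite mxE.
Qed.

Lemma adm_cst n (c : R) : adm (fun _ : 'rV[R]_n => c).
Proof. by apply: (@adm_continuous _ _ `|c|) => y _; [exact: cst_continuous|exact: lexx]. Qed.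

Lemma ballfD n (F G : 'rV[R]_n -> R) y : ballf (fun z => F z + G z) y = ballf F y + ballf G y.
Proof. by rewrite /ballf; case: ifP => // _; rewrite addr0. Qed.

Lemma ballfM n (F G : 'rV[R]_n -> R) y : ballf (fun z => F z * G z) y = ballf F y * ballf G y.
Proof. by rewrite /ballf; case: ifP => // _; rewrite mulr0. Qed.

Lemma ballfZ n c (F : 'rV[R]_n -> R) y : ballf (fun z => c * F z) y = c * ballf F y.
Proof. by rewrite /ballf; case: ifP => // _; rewrite mulr0. Qed.

Lemma admD n (F G : 'rV[R]_n -> R) : adm F -> adm G -> adm (fun y => F y + G y).
Proof.
move=> [K nF] [L nG]; exists (K + L); split.
- under eq_fun do rewrite ballfD.
  by apply: measurable_funD; [exact: (nice_meas nF)|exact: (nice_meas nG)].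
- move=> z s sn; rewrite ballfD (le_trans (ler_normD _ _))// lerD//.
    exact: (nice_bound nF).
  exact: (nice_bound nG).
- by move=> _ s; exact: ballf_supp.
Qed.

Lemma admM n (F G : 'rV[R]_n -> R) : adm F -> adm G -> adm (fun y => F y * G y).
Proof.
move=> [K nF] [L nG]; exists (K * L); split.
- under eq_fun do rewrite ballfM.
  by apply: measurable_funM; [exact: (nice_meas nF)|exact: (nice_meas nG)].
- move=> z s sn; rewrite ballfM normrM ler_pM//.
    exact: (nice_bound nF).
  exact: (nice_bound nG).
- by move=> _ s; exact: ballf_supp.
Qed.

Lemma admZ n c (F : 'rV[R]_n -> R) : adm F -> adm (fun y => c * F y).
Proof. by move=> aF; apply: admM => //; exact: adm_cst. Qed.

Lemma admN n (F : 'rV[R]_n -> R) : adm F -> adm (fun y => - F y).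
Proof. by under eq_fun do rewrite -mulN1r; exact: admZ. Qed.

Lemma admB n (F G : 'rV[R]_n -> R) : adm F -> adm G -> adm (fun y => F y - G y).
Proof. by move=> aF aG; apply: admD => //; exact: admN. Qed.

Lemma admX n (F : 'rV[R]_n -> R) k : adm F -> adm (fun y => F y ^+ k).
Proof.
move=> aF; elim: k => [|k IH]; first exact: adm_cst.
by under eq_fun do rewrite exprS; exact: admM.
Qed.

Lemma adm_sum n (I : Type) (r : seq I) (P : pred I) (F : I -> 'rV[R]_n -> R) :
  (forall i, P i -> adm (F i)) -> adm (fun y => \sum_(i <- r | P i) F i y).
Proof.
move=> aF; elim: r => [|i r IH].
  by under eq_fun do rewrite big_nil; exact: adm_cst.
under eq_fun do rewrite big_cons.
by have [/aF Pi|_] := boolP (P i) => //; exact: admD.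
Qed.

Lemma adm_prod n (I : Type) (r : seq I) (P : pred I) (F : I -> 'rV[R]_n -> R) :
  (forall i, P i -> adm (F i)) -> adm (fun y => \prod_(i <- r | P i) F i y).
Proof.
move=> aF; elim: r => [|i r IH].
  by under eq_fun do rewrite big_nil; exact: adm_cst.
under eq_fun do rewrite big_cons.
by have [/aF Pi|_] := boolP (P i) => //; exact: admM.
Qed.

Lemma adm_dotv n (x : 'rV[R]_n) : adm (dotv x).
Proof. by apply: adm_sum => i _; apply: admZ; exact: adm_coord. Qed.

(* Since [radial 0 = 0] is not on the sphere, [ballf F] and [ballf G] may differ at the origin. *)
Lemma adm_eq n (F G : 'rV[R]_n -> R) :
  (forall y, dotv y y = 1 -> F y = G y) -> adm F -> adm G.
Proof.
move=> FG [K nF].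
have E (s : seq R) : ballf G (vec_of_seq n s) =
    if dotv (vec_of_seq n s) (vec_of_seq n s) == 0 then G 0 else ballf F (vec_of_seq n s).
  rewrite dotv_eq0; case: eqVneq => [->|y0]; rewrite /ballf ?radial0.
    by rewrite enorm_le1 (_ : dotv 0 0 = 0) ?ler01//; apply/eqP; rewrite dotv_eq0.
  by case: ifP => // _; rewrite FG// dotv_radial.
exists (Num.max K `|G 0|); split.
- under eq_fun do rewrite E.
  apply: measurable_fun_ifT => //; last exact: (nice_meas nF).
  by apply: measurable_fun_eqr => //; exact: measurable_dotv_vec.
- move=> z s sn; rewrite E le_max; case: ifP => _; rewrite ?lexx ?orbT//.
  by rewrite (nice_bound nF).
- by move=> _ s; exact: ballf_supp.
Qed.

Lemma ball_intD n (F G : 'rV[R]_n -> R) : adm F -> adm G ->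
  ball_int (fun y => F y + G y) = ball_int F + ball_int G.
Proof.
move=> [K nF] [L nG]; rewrite -[RHS](iter_intD tt ler01 ler01 nF nG).
by apply: iter_int_ext => s _; exact: ballfD.
Qed.

Lemma ball_intZ n c (F : 'rV[R]_n -> R) : adm F ->
  ball_int (fun y => c * F y) = c * ball_int F.
Proof.
move=> [K nF]; rewrite -[RHS](iter_intZ c tt ler01 nF).
by apply: iter_int_ext => s _; exact: ballfZ.
Qed.

Lemma ball_int_cst n c : ball_int (fun _ : 'rV[R]_n => c) = c * ball_int (fun _ : 'rV[R]_n => 1).
Proof.
rewrite -ball_intZ; last exact: adm_cst.
by congr ball_int; apply/funext => y; rewrite mulr1.
Qed.

Lemma ball_intN n (F : 'rV[R]_n -> R) : adm F ->
  ball_int (fun y => - F y) = - ball_int F.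
Proof. by move=> aF; under eq_fun do rewrite -mulN1r; rewrite ball_intZ// mulN1r. Qed.

Lemma ball_intB n (F G : 'rV[R]_n -> R) : adm F -> adm G ->
  ball_int (fun y => F y - G y) = ball_int F - ball_int G.
Proof. by move=> aF aG; rewrite ball_intD ?ball_intN//; exact: admN. Qed.

Lemma ball_int_sum n (I : Type) (r : seq I) (P : pred I) (F : I -> 'rV[R]_n -> R) :
  (forall i, P i -> adm (F i)) ->
  ball_int (fun y => \sum_(i <- r | P i) F i y) = \sum_(i <- r | P i) ball_int (F i).
Proof.
move=> aF; elim: r => [|i r IH].
  under eq_fun do rewrite big_nil; rewrite big_nil.
  have := ball_intZ 0 (adm_cst n 0).
  by under eq_fun do rewrite mul0r; rewrite mul0r.
under eq_fun do rewrite big_cons; rewrite big_cons.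
have [/aF Pi|_] := boolP (P i) => //.
by rewrite ball_intD ?IH//; exact: adm_sum.
Qed.

(** The two extensions can differ only at the origin, which lies in the hyperplane where the first
    coordinate vanishes; this is a null set for the outermost integral. *)
Lemma ball_int_eq n (F G : 'rV[R]_n -> R) : (0 < n)%N ->
  adm F -> adm G -> (forall y, dotv y y = 1 -> F y = G y) -> ball_int F = ball_int G.
Proof.
case: n F G => // n F G _ [K nF] [L nG] FG.
have iF := iter_int_integrable tt ler01 nF.
have iG := iter_int_integrable tt ler01 nG.
rewrite /ball_int /leb_int /= /Rintegral; congr fine.
apply: ae_eq_integral => //; [by case/integrableP: iF|by case/integrableP: iG|].
exists [set 0]; split; [exact: measurable_set1|exact: lebesgue_measure_set1|].
move=> t /= h; apply: contrapT => /eqP t0; apply: h => _; congr EFin.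
apply: iter_int_ext => s sn; rewrite /ballf; case: ifP => // _; apply: FG.
apply: dotv_radial; apply/negP => /eqP/rowP/(_ ord0).
by rewrite !mxE/= => /eqP; rewrite (negbTE t0).
Qed.

Lemma ball_int_le n (F G : 'rV[R]_n -> R) : (0 < n)%N ->
  adm F -> adm G -> (forall y, dotv y y = 1 -> F y <= G y) -> ball_int F <= ball_int G.
Proof.
move=> n0 aF aG FG.
(* Replacing both functions by 0 off the sphere makes the pointwise inequality hold at the origin as
   well. *)
pose cut (H : 'rV[R]_n -> R) y := if dotv y y == 1 then H y else 0.
have cutE H y : dotv y y = 1 -> H y = cut H y by rewrite /cut => ->; rewrite eqxx.
have aF' := adm_eq (cutE F) aF; have aG' := adm_eq (cutE G) aG.
rewrite (ball_int_eq n0 aF aF' (cutE F)) (ball_int_eq n0 aG aG' (cutE G)).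
case: aF' => K nF; case: aG' => L nG.
apply: (le_iter_int tt ler01 ler01 nF nG) => _ s sn; rewrite /ballf; case: ifP => // _.
by rewrite /cut; case: eqP => // /FG.
Qed.

End ball_integral.

(** * Rotation invariance and its infinitesimal form *)

Section rotation_invariance.
Variables (R : realType) (n : nat).
Implicit Types (y x : 'rV[R]_n) (i j k : 'I_n) (t : R).

(* [t] is the tangent of the half-angle: [sigma t] is the sine and [1 - t * sigma t] the cosine of the
   rotation, so that the rotation is a product of three shears with coefficients rational in [t]. *)
Definition sigma t : R := 2 * t / (1 + t ^+ 2).

Definition rotv i j t y : 'rV[R]_n :=
  y + (- sigma t * (t * y 0 i + y 0 j)) *: 'e_i + (sigma t * (y 0 i - t * y 0 j)) *: 'e_j.

Lemma sigmaE t : sigma t * (1 + t ^+ 2) = 2 * t.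
Proof.
by rewrite /sigma divfK// gt_eqF// ltr_wpDr ?sqr_ge0.
Qed.

Lemma dotv_ei y i : dotv y 'e_i = y 0 i.
Proof.
rewrite /dotv (bigD1 i)//= mxE !eqxx mulr1 big1 ?addr0// => j /negbTE ji.
by rewrite mxE ji andbF mulr0.
Qed.

Lemma rotvE i j t y k : rotv i j t y 0 k = y 0 k +
  (if k == i then - sigma t * (t * y 0 i + y 0 j) else 0) +
  (if k == j then sigma t * (y 0 i - t * y 0 j) else 0).
Proof.
by rewrite !mxE eqxx/=; case: (k == i); case: (k == j); rewrite ?mulr1 ?mulr0.
Qed.

Lemma dotv_rotv i j t y : i != j -> dotv (rotv i j t y) (rotv i j t y) = dotv y y.
Proof.
move=> ij; rewrite /rotv !dotvDl !dotvDr !dotvZl !dotvZr.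
rewrite !(dotvC 'e_i) !(dotvC 'e_j) !dotv_ei !mxE !eqxx/= (eq_sym j i) (negbTE ij)/=.
move: (sigmaE t); set s := sigma t => sE.
rewrite !mulr1 !mulr0.
set A := dotv y y; set a := y 0 i; set b := y 0 j.
(* The change of the squared norm is exactly this multiple of the relation that defines [sigma]. *)
have key : s * (a ^+ 2 + b ^+ 2) * (s * (1 + t ^+ 2) - 2 * t) = 0 by rewrite sE subrr mulr0.
rewrite -[RHS](addr0 A) -[in RHS]key; ring.
Qed.

Lemma rotvZ i j t a y : rotv i j t (a *: y) = a *: rotv i j t y.
Proof.
rewrite /rotv !mxE !scalerDr !scalerA; congr (_ + _ *: _ + _ *: _); ring.
Qed.

Lemma enorm_rotv i j t y : i != j -> enorm (rotv i j t y) = enorm y.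
Proof. by move=> ij; rewrite /enorm dotv_rotv. Qed.

Lemma radial_rotv i j t y : i != j -> radial (rotv i j t y) = rotv i j t (radial y).
Proof. by move=> ij; rewrite /radial enorm_rotv// rotvZ. Qed.

Lemma vec_shear3 i j t (s : seq R) : i != j -> size s = n ->
  vec_of_seq n (shear i j (- t) (shear j i (sigma t) (shear i j (- t) s))) =
  rotv i j t (vec_of_seq n s).
Proof.
move=> ij sn; apply/rowP => k; rewrite rotvE !vec_of_seq_coord !nth_trans.
have E (a b : 'I_n) : ((a : nat) == b) = (a == b) by [].
rewrite !E !eqxx (eq_sym j i) (negbTE ij) !addr0.
move: (sigmaE t); set g := sigma t; set a := nth 0 s i; set b := nth 0 s j => sE.
have [ki|ki] := eqVneq k i; have [kj|kj] := eqVneq k j.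
- by move: ij; rewrite -ki kj eqxx.
- rewrite ki -/a !addr0.
  have E2 : 2 * t = g + g * t ^+ 2 by rewrite -sE; ring.
  apply/eqP; rewrite -subr_eq0; apply/eqP.
  transitivity (b * (g + g * t ^+ 2 - 2 * t)); first by ring.
  by rewrite E2 subrr mulr0.
- by rewrite kj -/b; ring.
- by rewrite !addr0.
Qed.

Lemma ballf_rotv (F : 'rV[R]_n -> R) i j t (s : seq R) : i != j -> size s = n ->
  ballf (fun y => F (rotv i j t y)) (vec_of_seq n s) =
  ballf F (vec_of_seq n (shear i j (- t) (shear j i (sigma t) (shear i j (- t) s)))).
Proof.
by move=> ij sn; rewrite vec_shear3// /ballf enorm_rotv// radial_rotv.
Qed.

(** Each shear preserves the iterated integral. The intermediate images of the ball leave the unit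
    cube, hence the growing radii of [n1], [n2], [n3]; the complete rotation preserves the ball, and
    radius 1 is recovered from [ballf_supp]. *)
Lemma ball_int_rotv (F : 'rV[R]_n -> R) i j t : i != j -> adm F ->
  adm (fun y => F (rotv i j t y)) /\ ball_int (fun y => F (rotv i j t y)) = ball_int F.
Proof.
move=> ij [K nF].
have [ni nj] := (ltn_ord i, ltn_ord j).
have ij' : (i : nat) != j by [].
have ji' : (j : nat) != i by rewrite eq_sym.
have n1 := nice_shear (- t) ler01 ni nj ij' nF.
have p1 : 0 <= 1 * (1 + `|- t|) by rewrite mul1r addr_ge0.
have n2 := nice_shear (sigma t) p1 nj ni ji' n1.
have p2 : 0 <= 1 * (1 + `|- t|) * (1 + `|sigma t|) by rewrite mulr_ge0// addr_ge0.
have n3 := nice_shear (- t) p2 ni nj ij' n2.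
split.
  exists K; split.
  - apply: eq_measurable_fun (nice_meas n3) => -[[] s] _ /=.
    by rewrite ballf_rotv// size_tuple.
  - by move=> z s sn; rewrite ballf_rotv//; exact: (nice_bound n3 tt).
  - by move=> _ s; exact: ballf_supp.
rewrite -[RHS](iter_int_shear (- t) tt ler01 ni nj ij' nF).
rewrite -[RHS](iter_int_shear (sigma t) tt p1 nj ni ji' n1).
rewrite -[RHS](iter_int_shear (- t) tt p2 ni nj ij' n2).
by apply: iter_int_ext => s sn; exact: ballf_rotv.
Qed.

Lemma adm_bound (F : 'rV[R]_n -> R) : adm F ->
  exists2 K, 0 <= K & forall y, dotv y y = 1 -> `|F y| <= K.
Proof.
move=> [K nF]; exists `|K| => // y y1.
pose s := [seq y 0 i | i <- enum 'I_n].
have sn : size s = n by rewrite size_map size_enum_ord.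
have sy : vec_of_seq n s = y.
  apply/rowP => i; rewrite mxE (nth_map i) ?size_enum_ord//.
  by rewrite nth_ord_enum.
apply: le_trans (ler_norm K).
have := nice_bound nF tt sn; rewrite sy /ballf sphere_radial//.
by rewrite enorm_le1 y1 lexx.
Qed.

(* [w] is half of the derivative of [u] along the rotations [rotv i j], with a uniform quadratic error. *)
Definition flow i j (u w : 'rV[R]_n -> R) : Prop :=
  [/\ adm u, adm w & exists C, forall t y, 0 < t <= 1 -> dotv y y = 1 ->
    `|u (rotv i j t y) - u y - 2 * t * w y| <= C * t ^+ 2].

(** By rotation invariance the increment of [u] integrates to 0, so 2t |I| <= C t^2 V for all t in
    (0, 1]; dividing by t and letting t tend to 0 forces I = 0. The uniform quadratic error replaces
    differentiation under the integral sign. *)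
Lemma flow_int0 i j u w : (0 < n)%N -> i != j -> flow i j u w -> ball_int w = 0.
Proof.
move=> n0 ij [au aw [C hC]].
set I := ball_int w; set V := ball_int (fun _ : 'rV[R]_n => 1).
have V0 : 0 <= V.
  have : ball_int (fun _ : 'rV[R]_n => 0) <= V.
    by apply: ball_int_le => //; exact: adm_cst.
  by rewrite ball_int_cst mul0r.
have bnd t : 0 < t <= 1 -> 2 * t * `|I| <= C * t ^+ 2 * V.
  move=> /[dup] t01 /andP[t0 _].
  have [ar Er] := ball_int_rotv t ij au.
  have aE : adm (fun y => 2 * t * w y) by exact: admZ.
  have aD : adm (fun y => u (rotv i j t y) - u y - 2 * t * w y) by do 2 apply: admB => //.
  have ED : ball_int (fun y => u (rotv i j t y) - u y - 2 * t * w y) = - (2 * t * I).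
    rewrite ball_intB ?ball_intZ ?ball_intB ?Er//; last exact: admB.
    by rewrite subrr sub0r.
  have Ec : ball_int (fun _ : 'rV[R]_n => C * t ^+ 2) = C * t ^+ 2 * V.
    exact: ball_int_cst.
  have t2 : 0 < 2 * t by rewrite mulr_gt0.
  rewrite -(gtr0_norm t2) -normrM -normrN -ED ler_norml; apply/andP; split.
    rewrite -Ec -ball_intN; last exact: adm_cst.
    apply: ball_int_le => //; first by apply: admN; exact: adm_cst.
    by move=> y /(hC _ _ t01); rewrite ler_norml => /andP[].
  rewrite -Ec; apply: ball_int_le => //; first exact: adm_cst.
  by move=> y /(hC _ _ t01); rewrite ler_norml => /andP[].
apply/eqP; rewrite -normr_le0 leNgt; apply/negP => I0.
have CV0 : 0 <= `|C| * V by rewrite mulr_ge0.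
(* This t gives |C| V t < |I|, against 2 |I| <= |C| V t. *)
pose t := Num.min 1 (`|I| / (`|C| * V + 1)).
have t0 : 0 < t by rewrite lt_min ltr01 divr_gt0// ltr_wpDl.
have t01 : 0 < t <= 1 by rewrite t0 ge_min lexx.
have h := bnd _ t01.
have tI : t * (`|C| * V + 1) <= `|I|.
  by rewrite -ler_pdivlMr ?ltr_wpDl// ge_min lexx orbT.
have h2 : C * t ^+ 2 * V <= `|C| * V * t ^+ 2.
  by rewrite mulrAC ler_wpM2r ?sqr_ge0// ler_wpM2r// ler_norm.
have h3 : 2 * t * `|I| <= `|C| * V * t * t by rewrite -[_ * t * t]mulrA -expr2; exact: le_trans h h2.
have h4 : 2 * `|I| <= `|C| * V * t.
  by rewrite -(ler_pM2r t0) mulrAC.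
lra.
Qed.

Lemma flow_cst i j c : flow i j (fun=> c) (fun=> 0).
Proof.
split; [exact: adm_cst|exact: adm_cst|exists 0 => t y _ _].
by rewrite subrr mulr0 subr0 normr0 mul0r.
Qed.

(** As 2t = [sigma t] + [sigma t] t^2, the remainder at each of the coordinates i and j combines
    [sigma t] t and [sigma t] t^2, both at most 2 t^2. This makes 4 for each coordinate, and 8
    bounds their sum. *)
Lemma flow_coord i j k : flow i j (fun y => y 0 k)
  (fun y => (if k == j then y 0 i else 0) - (if k == i then y 0 j else 0)).
Proof.
split; first exact: adm_coord.
  apply: admB; first by case: (k == j); [exact: adm_coord|exact: adm_cst].
  by case: (k == i); [exact: adm_coord|exact: adm_cst].
exists 8 => t y /andP[t0 t1] y1; rewrite rotvE.
have sE := sigmaE t; set g := sigma t in sE *.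
have g0 : 0 <= g by rewrite /g /sigma divr_ge0// ?mulr_ge0 ?(ltW t0)// addr_ge0// sqr_ge0.
have g2 : g <= 2 * t by rewrite -sE ler_peMr// lerDl sqr_ge0.
have gt : g * t <= 2 * t ^+ 2 by rewrite expr2 mulrA ler_wpM2r// ltW.
have gt0 : 0 <= g * t by rewrite mulr_ge0// ltW.
have gt2 : g * t ^+ 2 <= 2 * t ^+ 2.
  by apply: le_trans gt; rewrite expr2 mulrA ler_piMr.
have gt20 : 0 <= g * t ^+ 2 by rewrite mulr_ge0// sqr_ge0.
have [yi yj] := (coord_sphere_le1 i y1, coord_sphere_le1 j y1).
have E1 : `|- g * (t * y 0 i + y 0 j) + 2 * t * y 0 j| <= 4 * t ^+ 2.
  rewrite -sE [X in `|X| <= _](_ : _ = g * t ^+ 2 * y 0 j - g * t * y 0 i); last by ring.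
  rewrite (le_trans (ler_normB _ _))// (_ : 4 = 2 + 2 :> R); last by ring.
  rewrite mulrDl lerD// normrM ger0_norm//.
    by apply: le_trans gt2; rewrite ler_piMr.
  by apply: le_trans gt; rewrite ler_piMr.
have E2 : `|g * (y 0 i - t * y 0 j) - 2 * t * y 0 i| <= 4 * t ^+ 2.
  rewrite -sE [X in `|X| <= _](_ : _ = - (g * t ^+ 2 * y 0 i) - g * t * y 0 j); last by ring.
  rewrite (le_trans (ler_normB _ _))// (_ : 4 = 2 + 2 :> R); last by ring.
  rewrite normrN mulrDl lerD// normrM ger0_norm//.
    by apply: le_trans gt2; rewrite ler_piMr.
  by apply: le_trans gt; rewrite ler_piMr.
have t20 : 0 <= 4 * t ^+ 2 by rewrite mulr_ge0// sqr_ge0.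
set a := - g * _ in E1 *; set b := g * _ in E2 *.
rewrite [X in `|X| <= _](_ : _ = (if k == i then a + 2 * t * y 0 j else 0) + (if k == j then b - 2 * t * y 0 i else 0)); last first.
  by case: (k == i); case: (k == j); ring.
rewrite (le_trans (ler_normD _ _))// (_ : 8 = 4 + 4 :> R); last by ring.
by rewrite (mulrDl 4 4) lerD//; case: ifP => // _; rewrite normr0.
Qed.

Lemma flowD i j u1 w1 u2 w2 : flow i j u1 w1 -> flow i j u2 w2 ->
  flow i j (fun y => u1 y + u2 y) (fun y => w1 y + w2 y).
Proof.
move=> [au1 aw1 [C1 h1]] [au2 aw2 [C2 h2]]; split; try exact: admD.
exists (C1 + C2) => t y t01 y1.
have {h1} := h1 _ _ t01 y1; have {h2} := h2 _ _ t01 y1.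
rewrite !ler_norml => /andP[? ?] /andP[? ?]; apply/andP; split; lra.
Qed.

Lemma flowM i j u1 w1 u2 w2 : i != j -> flow i j u1 w1 -> flow i j u2 w2 ->
  flow i j (fun y => u1 y * u2 y) (fun y => w1 y * u2 y + u1 y * w2 y).
Proof.
move=> ij [au1 aw1 [C1 h1]] [au2 aw2 [C2 h2]]; split; first exact: admM.
  by apply: admD; exact: admM.
have [K1 K10 b1] := adm_bound au1; have [K2 K20 b2] := adm_bound au2.
have [L1 L10 c1] := adm_bound aw1; have [L2 L20 c2] := adm_bound aw2.
exists (4 * L1 * L2 + C1 * K2 + (K1 + 2 * L1) * C2) => t y /[dup] t01 /andP[t0 t1] y1.
have := b2 _ (etrans (dotv_rotv t y ij) y1).
have {h1} := h1 _ _ t01 y1; have {h2} := h2 _ _ t01 y1.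
have {b1} := b1 _ y1; have {b2} := b2 _ y1; have {c1} := c1 _ y1; have {c2} := c2 _ y1.
set U1 := u1 (rotv _ _ _ _); set U2 := u2 (rotv _ _ _ _).
set v1 := u1 y; set v2 := u2 y; set x1 := w1 y; set x2 := w2 y.
move=> hx2 hx1 hv2 hv1 he2 he1 hU2.
(* Leibniz rule with predictions v + 2tx: the error of the first factor meets the exact value [U2],
   that of the second meets the prediction of the first, and the product of the predictions leaves 4
   x1 x2 t^2. *)
rewrite [X in `|X| <= _](_ : _ = 4 * x1 * x2 * t ^+ 2 + (U1 - v1 - 2 * t * x1) * U2 + (v1 + 2 * t * x1) * (U2 - v2 - 2 * t * x2)); last by ring.
have t2 : 0 <= t ^+ 2 by exact: sqr_ge0.
have B1 : `|4 * x1 * x2 * t ^+ 2| <= 4 * L1 * L2 * t ^+ 2.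
  rewrite 3!normrM (ger0_norm t2) ler_wpM2r//.
  have x12 : `|x1| * `|x2| <= L1 * L2 by rewrite ler_pM.
  by rewrite -2!mulrA (ger0_norm (_ : 0 <= 4))// ler_wpM2l.
have B2 : `|(U1 - v1 - 2 * t * x1) * U2| <= C1 * K2 * t ^+ 2.
  by rewrite normrM (mulrAC C1) ler_pM.
have B3 : `|(v1 + 2 * t * x1) * (U2 - v2 - 2 * t * x2)| <= (K1 + 2 * L1) * C2 * t ^+ 2.
  rewrite normrM -[X in _ <= X]mulrA ler_pM//.
  rewrite (le_trans (ler_normD _ _))// lerD// !normrM (ger0_norm (_ : 0 <= 2))// (gtr0_norm t0).
  by rewrite -mulrA ler_wpM2l// (le_trans _ hx1)// ler_piMl.
apply: (le_trans (ler_normD _ _)); rewrite (mulrDl _ _ (t ^+ 2)) lerD//.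
by apply: (le_trans (ler_normD _ _)); rewrite (mulrDl _ _ (t ^+ 2)) lerD.
Qed.

Lemma flow_sum i j (I : Type) (r : seq I) (u w : I -> 'rV[R]_n -> R) :
  (forall k : I, flow i j (u k) (w k)) ->
  flow i j (fun y => \sum_(k <- r) u k y) (fun y => \sum_(k <- r) w k y).
Proof.
move=> h; elim: r => [|k r IH].
  by under eq_fun do rewrite big_nil; under [X in flow _ _ _ X]eq_fun do rewrite big_nil; exact: flow_cst.
under eq_fun do rewrite big_cons; under [X in flow _ _ _ X]eq_fun do rewrite big_cons.
exact: flowD.
Qed.

Lemma flowZ i j c u w : i != j -> flow i j u w -> flow i j (fun y => c * u y) (fun y => c * w y).
Proof.
move=> ij h; have := flowM ij (flow_cst i j c) h.
by under [X in flow _ _ _ X]eq_fun do rewrite mul0r add0r.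
Qed.

Lemma flowX i j u w p : i != j -> flow i j u w ->
  flow i j (fun y => u y ^+ p.+1) (fun y => p.+1%:R * (u y ^+ p * w y)).
Proof.
move=> ij h; elim: p => [|p IH].
  by under [X in flow _ _ _ X]eq_fun do rewrite expr0 !mul1r.
under eq_fun do rewrite exprS.
have := flowM ij h IH; congr flow; apply/funext => y.
by rewrite [RHS]mulrC -[in RHS]natr1 !exprS; ring.
Qed.

End rotation_invariance.

(** * Moments of the kernel *)

Section moments.
Variables (R : realType) (n : nat) (x : 'rV[R]_n).
Hypothesis (n0 : (0 < n)%N) (x1 : dotv x x = 1).
Local Notation q p := (fun y : 'rV[R]_n => (1 + dotv x y) ^+ p).

Lemma adm_q p : adm (q p).
Proof. by apply: admX; apply: admD; [exact: adm_cst|exact: adm_dotv]. Qed.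

Lemma flow_dotv (i j : 'I_n) : i != j ->
  flow i j (dotv x) (fun y => x 0 j * y 0 i - x 0 i * y 0 j).
Proof.
move=> ij; have := flow_sum (index_enum 'I_n) (fun k => flowZ (x 0 k) ij (flow_coord R i j k)).
congr flow; apply/funext => y.
rewrite (bigD1 j)//= (bigD1 i)//= !eqxx (eq_sym j i) (negbTE ij) subr0 sub0r mulrN.
by rewrite big1 ?addr0// => k /andP[/negbTE-> /negbTE->]; rewrite subr0 mulr0.
Qed.

Lemma flow_q (i j : 'I_n) p : i != j ->
  flow i j (q p.+1) (fun y => p.+1%:R * (q p y * (x 0 j * y 0 i - x 0 i * y 0 j))).
Proof.
move=> ij; have := flowX p ij (flowD (flow_cst i j 1) (flow_dotv ij)).
by under [X in flow _ _ _ X]eq_fun do rewrite add0r.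
Qed.

Lemma ball_int_0 : ball_int (fun _ : 'rV[R]_n => 0) = 0 :> R.
Proof. by rewrite ball_int_cst mul0r. Qed.

(** Rotating in the plane (j, k) shows that q^p (x_k y_j - x_j y_k) has integral 0, where q = 1 +
    <x, y>. Weighting by x_j and summing over j gives the claim, as |x| = 1. *)
Lemma moment_first p k :
  ball_int (fun y => q p y * y 0 k) = x 0 k * ball_int (fun y => q p y * dotv x y).
Proof.
have aq := adm_q p.
have ac j : adm (fun y : 'rV[R]_n => y 0 j) by exact: adm_coord.
have aT := adm_dotv x.
have a0 j : adm (fun y => q p y * (x 0 k * y 0 j - x 0 j * y 0 k)).
  by apply: admM => //; apply: admB; apply: admZ.
have h j : ball_int (fun y => q p y * (x 0 k * y 0 j - x 0 j * y 0 k)) = 0.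
  have [->|jk] := eqVneq j k.
    by under eq_fun do rewrite subrr mulr0; exact: ball_int_0.
  have := flow_int0 n0 jk (flow_q p jk); rewrite ball_intZ//.
  by move/eqP; rewrite mulf_eq0 pnatr_eq0 => /eqP.
have : ball_int (fun y => \sum_j x 0 j * (q p y * (x 0 k * y 0 j - x 0 j * y 0 k))) = 0.
  rewrite ball_int_sum; last by move=> j _; apply: admZ.
  by rewrite big1// => j _; rewrite ball_intZ// h mulr0.
rewrite (_ : (fun y => _) = (fun y => x 0 k * (q p y * dotv x y) - q p y * y 0 k)).
  rewrite ball_intB ?ball_intZ//; [|exact: admM|by apply: admZ; exact: admM|exact: admM].
  by move/eqP; rewrite subr_eq0 => /eqP.
apply/funext => y; rewrite -[X in _ - X]mul1r -x1 mulrCA /dotv !mulr_sumr mulr_suml -sumrB.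
by apply: eq_bigr => j _; ring.
Qed.

(** Integration by parts on the sphere: with q = 1 + <x, y>, the rotation in the plane (j, k) is
    applied to y_k q^(p+1). Weighted by x_j and summed over j and k, the derivatives give (n - 1)
    <x, y> q^(p+1) + (p + 1) q^p (<x, y>^2 - 1) on the sphere, and the last factor is -q (1 - <x,
    y>). *)
Lemma moment_second p :
  p.+1%:R * ball_int (fun y => q p.+1 y * (1 - dotv x y)) =
  (n%:R - 1) * ball_int (fun y => q p.+1 y * dotv x y).
Proof.
have aq r := adm_q r.
have ac j : adm (fun y : 'rV[R]_n => y 0 j) by exact: adm_coord.
have aT := adm_dotv x.
have aT1 : adm (fun y => 1 - dotv x y) by apply: admB => //; exact: adm_cst.
(* On the diagonal there is no rotation: the first term is set to 0 there and the second vanishes by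
   itself. *)
pose D (j k : 'I_n) (y : 'rV[R]_n) := (if j == k then 0 else y 0 j * q p.+1 y) +
   p.+1%:R * (y 0 k * (q p y * (x 0 k * y 0 j - x 0 j * y 0 k))).
have aD j k : adm (D j k).
  apply: admD; first by case: (j == k); [exact: adm_cst|exact: admM].
  apply: admZ; apply: admM => //; apply: admM => //.
  by apply: admB; apply: admZ.
have h j k : ball_int (D j k) = 0.
  rewrite /D; have [->|jk] := eqVneq j k.
    by under eq_fun do rewrite subrr !mulr0 addr0; exact: ball_int_0.
  have := flow_int0 n0 jk (flowM jk (flow_coord R j k k) (flow_q p jk)).
  move=> <-; congr ball_int; apply/funext => y.
  by rewrite eqxx (eq_sym k j) (negbTE jk) subr0; ring.
have hs : ball_int (fun y => \sum_k \sum_j x 0 j * D j k y) = 0.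
  have aDD j k : adm (fun y => x 0 j * D j k y) by exact: admZ.
  rewrite ball_int_sum; last by move=> k _; apply: adm_sum.
  rewrite big1// => k _; rewrite ball_int_sum// big1// => j _.
  by rewrite ball_intZ// h mulr0.
have a1 : adm (fun y => q p.+1 y * dotv x y) by exact: admM.
have a2 : adm (fun y => q p.+1 y * (1 - dotv x y)) by exact: admM.
apply/eqP; rewrite eq_sym -subr_eq0 -!ball_intZ// -ball_intB//; try exact: admZ.
rewrite -hs; apply/eqP; apply: ball_int_eq => //.
- by apply: admB; exact: admZ.
- by apply: adm_sum => k _; apply: adm_sum => j _; exact: admZ.
move=> y y1.
transitivity (\sum_k (\sum_j x 0 j * (y 0 j * q p.+1 y) - x 0 k * (y 0 k * q p.+1 y)
   + p.+1%:R * q p y * (y 0 k * x 0 k * dotv x y - y 0 k ^+ 2))); last first.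
  apply: eq_bigr => k _.
  rewrite [RHS](eq_bigr (fun j => x 0 j * (if j == k then 0 else y 0 j * q p.+1 y) + x 0 j * (p.+1%:R * (y 0 k * (q p y * (x 0 k * y 0 j - x 0 j * y 0 k)))))); last first.
    by move=> j _; rewrite mulrDr.
  rewrite [RHS]big_split/=; congr (_ + _).
    rewrite (bigD1 k)//= addrC addrK [RHS](bigD1 k)//= eqxx mulr0 add0r.
    by apply: eq_bigr => j /negbTE ->.
  rewrite -[X in _ - X]mulr1 -[in X in _ - X]x1 /dotv !mulr_sumr -sumrB mulr_sumr.
  by apply: eq_bigr => j _; ring.
rewrite big_split/= sumrB sumr_const card_ord -mulr_natl.
have S1 : \sum_j x 0 j * (y 0 j * q p.+1 y) = dotv x y * q p.+1 y.
  by rewrite /dotv mulr_suml; apply: eq_bigr => j _; rewrite mulrA.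
have S2 : \sum_k p.+1%:R * q p y * (y 0 k * x 0 k * dotv x y - y 0 k ^+ 2) =
    p.+1%:R * q p y * (dotv x y ^+ 2 - 1).
  rewrite -mulr_sumr sumrB -mulr_suml; congr (_ * (_ - _)).
    by rewrite expr2; congr (_ * _); apply: eq_bigr => k _; rewrite mulrC.
  by rewrite -y1; apply: eq_bigr => k _; rewrite expr2.
rewrite S1 S2 exprS; ring.
Qed.

Lemma dotv_sphere_le1 y : dotv y y = 1 -> dotv x y <= 1.
Proof. by move=> y1; case/andP: (dotv_sphere_itv x1 y1). Qed.

Lemma q_ge0 p y : dotv y y = 1 -> 0 <= (1 + dotv x y) ^+ p.
Proof.
by move=> y1; case/andP: (dotv_sphere_itv x1 y1) => h _; rewrite exprn_ge0//; lra.
Qed.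

Definition ksq k (y : 'rV[R]_n) : R := phi x k y ^+ 2.

Lemma ksqE k y : ksq k y = (2 ^- (k * 2)) * (1 + dotv x y) ^+ (k * 2).
Proof. by rewrite /ksq /phi -exprM expr_div_n addrC mulrC. Qed.

Lemma adm_phi k : adm (phi x k).
Proof.
apply: admX; apply: admM; last exact: adm_cst.
by apply: admD; [exact: adm_dotv|exact: adm_cst].
Qed.

Lemma adm_ksq k : adm (ksq k).
Proof. exact/admX/adm_phi. Qed.

Lemma ksq_ge0 k y : 0 <= ksq k y.
Proof. exact: sqr_ge0. Qed.

Lemma ksq_moment_first k i :
  ball_int (fun y => ksq k y * y 0 i) = x 0 i * ball_int (fun y => ksq k y * dotv x y).
Proof.
under eq_fun do rewrite ksqE -mulrA; under [in RHS]eq_fun do rewrite ksqE -mulrA.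
have aq := adm_q (k * 2).
rewrite !(ball_intZ (2 ^- (k * 2))); [|by apply: admM => //; exact: adm_dotv|by apply: admM => //; exact: adm_coord].
by rewrite moment_first mulrCA.
Qed.

(** The second moment identity at exponent 2k, with <x, y> <= 1 and n - 1 <= n. As 2 (1 - <x, y>) is
    the squared distance from x to y, it bounds the mean squared distance under the kernel by
    n/k. *)
Lemma ksq_concentration k : (0 < k)%N ->
  ball_int (fun y => ksq k y * (1 - dotv x y)) <= n%:R / (2 * k%:R) * ball_int (ksq k).
Proof.
move=> k0.
have aT := adm_dotv x.
have aT1 : adm (fun y => 1 - dotv x y) by apply: admB => //; exact: adm_cst.
have aq := adm_q (k * 2).
have kp : (k * 2)%N = (k * 2).-1.+1 by rewrite prednK// muln_gt0 k0.
have := moment_second (k * 2).-1; rewrite -kp => H.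
have H2 : ball_int (fun y => q (k * 2)%N y * dotv x y) <= ball_int (q (k * 2)%N).
  apply: ball_int_le => //; first exact: admM.
  by move=> y y1; rewrite ler_piMr ?q_ge0// dotv_sphere_le1.
have I0 : 0 <= ball_int (q (k * 2)%N).
  rewrite -ball_int_0; apply: ball_int_le => //; first exact: adm_cst.
  by move=> y y1; exact: q_ge0.
rewrite (_ : ksq k = (fun y => (2 ^- (k * 2)) * q (k * 2)%N y)); last by apply/funext => y; exact: ksqE.
under eq_fun do rewrite -mulrA.
rewrite !(ball_intZ (2 ^- (k * 2)))//; last exact: admM.
rewrite [leRHS]mulrCA ler_wpM2l ?invr_ge0 ?exprn_ge0//.
have kk : 0 < 2 * k%:R :> R by rewrite mulr_gt0// ltr0n.
rewrite mulrAC ler_pdivlMr// mulrC.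
rewrite [X in X * _ <= _](_ : _ = (k * 2)%:R) ?H; last by rewrite natrM mulrC.
apply: (@le_trans _ _ ((n%:R - 1) * ball_int (q (k * 2)%N))).
  by rewrite ler_wpM2l// subr_ge0 ler1n.
by rewrite ler_wpM2r// lerBlDl lerDr.
Qed.

End moments.

(** * Lower bound for the mass of the kernel *)

Section lower_bound.
Variable R : realType.
Local Notation mu := (@lebesgue_measure R).

Definition box n (c : nat -> R) (e : R) (s : seq R) : R :=
  \prod_(i < n) (if `|nth 0 s i - c i| <= e then 1 else 0).

Lemma iter_int_box n (c : nat -> R) (e : R) : 0 <= e ->
  iter_int n (box n c e) = (2 * e) ^+ n.
Proof.
move=> e0; elim: n c => [|n IH] c; first by rewrite /box /= big_ord0.
rewrite /= exprS.
have E t : iter_int n (fun s => box n.+1 c e (t :: s)) =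
    if `|t - c 0%N| <= e then (2 * e) ^+ n else 0.
  case: ifPn => tc.
    rewrite -(IH (c \o S)); apply: iter_int_ext => s _.
    by rewrite /box big_ord_recl /= tc mul1r.
  rewrite -[RHS](@iter_int0 R n); apply: iter_int_ext => s _.
  by rewrite /box big_ord_recl /= (negbTE tc) mul0r.
under eq_Rintegral do rewrite E.
transitivity (\int[mu]_(t in `[c 0%N - e, c 0%N + e]) (2 * e) ^+ n).
  rewrite [RHS]Rintegral_mkcond; apply: eq_Rintegral => t _; rewrite /patch.
  by rewrite mem_setE in_itv/= ler_distl.
rewrite Rintegral_cst// [X in fine X]lebesgue_measure_itv/= lte_fin mulrC; congr (_ * _).
case: ltP => h /=; first by ring.
by move: h; lra.
Qed.

Lemma nice_box n (c : nat -> R) (e a : R) : (forall i, (i < n)%N -> `|c i| + e <= 1) -> 0 <= a ->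
  nice n 1 a (fun (_ : unit) s => a * box n c e s).
Proof.
move=> ce a0; split.
- apply: measurable_funM => //; apply: measurable_prod => i _.
  apply: measurable_fun_ifT => //; apply: measurable_fun_ler => //.
  by apply: measurableT_comp => //; apply: measurable_funB => //; exact: measurable_nth_tuple.
- move=> _ s _; rewrite normrM (ger0_norm a0) ler_piMr// /box normr_prod.
  by rewrite prodr_ile1// => i _; case: ifP; rewrite ?normr1 ?normr0 ?lexx ?ler01.
- move=> _ s sn /(has_nthP 0)[i si h]; rewrite sn in si.
  rewrite /box (bigD1 (Ordinal si))//=; case: ifP => h2; rewrite ?mul0r ?mulr0//.
  have := ler_normD (nth 0 s i - c i) (c i); rewrite subrK => h3.
  by have := ce _ si; move: h h2 h3; lra.
Qed.

Lemma bernoulli_le (u : R) m : 0 <= u <= 1 -> 1 - m%:R * u <= (1 - u) ^+ m.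
Proof.
move=> /andP[u0 u1]; elim: m => [|m IH]; first by rewrite mul0r subr0 expr0.
rewrite exprS; apply: (@le_trans _ _ ((1 - u) * (1 - m%:R * u))); last first.
  by rewrite ler_wpM2l// subr_ge0.
rewrite -natr1.
have : 0 <= m%:R * u * u by rewrite !mulr_ge0.
lra.
Qed.

(** Near x/2 one is both inside the ball and away from the origin. The side of the cube makes |y -
    x/2| at most e = 1/(8k); then 1 - <x, radial y> <= 4e, and Bernoulli gives (1 - 2e)^(2k) >= 1 -
    4ke = 1/2. *)
Lemma phi_near_half n (x y : 'rV[R]_n) k : (0 < n)%N -> dotv x x = 1 -> (0 < k)%N ->
  (forall i, `|y 0 i - x 0 i / 2| <= (8 * k%:R * n%:R)^-1) ->
  enorm y <= 1 /\ 1 / 2 <= ksq x k (radial y).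
Proof.
move=> n0 x1 k0 h.
have k1 : 1 <= k%:R :> R by rewrite ler1n.
have n1 : 1 <= n%:R :> R by rewrite ler1n.
set w := y - 2^-1 *: x.
have yE : y = 2^-1 *: x + w by rewrite /w addrC subrK.
pose e : R := (8 * k%:R)^-1.
have e0 : 0 < e by rewrite invr_gt0 mulr_gt0// ltr0n.
have e8 : e <= 8^-1 by rewrite lef_pV2 ?posrE// ?mulr_gt0 ?ltr0n// ler_peMr.
have ew : enorm w <= e.
  have -> : e = n%:R * (8 * k%:R * n%:R)^-1.
    by rewrite [(_ * n%:R)^-1]invfM mulrCA mulfV ?mulr1// gt_eqF// ltr0n.
  by apply: enorm_coord_bound => i; rewrite !mxE mulrC h.
have xx : enorm x = 1 by rewrite /enorm x1 sqrtr1.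
have ey : enorm y <= 1 / 2 + e.
  rewrite yE (le_trans (enormD _ _))// enormZ xx lerD//.
  by rewrite ger0_norm ?invr_ge0// mulr1 div1r.
have dy : 1 / 2 - e <= dotv x y.
  rewrite yE dotvDr dotvZr x1 mulr1 div1r lerD2l lerNl -dotvNr.
  by rewrite (le_trans (dotv_le_enorm _ _))// xx mul1r -scaleN1r enormZ normrN1 mul1r.
split; first by lra.
have y0 : 0 < enorm y.
  rewrite enorm_gt0; apply/eqP => y0; move: dy.
  by rewrite y0 -(scale0r (0 : 'rV[R]_n)) dotvZr mul0r; lra.
have T : 1 - 4 * e <= dotv x (radial y).
  rewrite /radial dotvZr [leRHS]mulrC ler_pdivlMr//.
  apply: le_trans dy; apply: (@le_trans _ _ ((1 - 4 * e) * (1 / 2 + e))).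
    by rewrite ler_wpM2l//; lra.
  have : 0 <= e * e by rewrite mulr_ge0// ltW.
  lra.
rewrite /ksq /phi -exprM.
apply: (@le_trans _ _ ((1 - 2 * e) ^+ (k * 2))); last first.
  by rewrite lerXn2r// ?nnegrE; lra.
apply: le_trans (bernoulli_le (k * 2) (_ : 0 <= 2 * e <= 1)); last by apply/andP; split; lra.
rewrite natrM /e (_ : k%:R * 2 * (2 * (8 * k%:R)^-1) = 1 / 2); first by lra.
by field; rewrite pnatr_eq0 -lt0n.
Qed.

(** The value 1/2 on the cube around x/2 times its volume (2e)^n, where 2e = 1/(4kn). The exponent
    of k is not sharp, but only has to be finite. *)
Lemma ball_int_ksq_lower n (x : 'rV[R]_n) k : (0 < n)%N -> dotv x x = 1 -> (0 < k)%N ->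
  1 / 2 * (4 * k%:R * n%:R) ^- n <= ball_int (ksq x k).
Proof.
move=> n0 x1 k0.
have [K nK] := adm_ksq x k.
have k1 : 1 <= k%:R :> R by rewrite ler1n.
have n1 : 1 <= n%:R :> R by rewrite ler1n.
pose e : R := (8 * k%:R * n%:R)^-1.
have e0 : 0 < e by rewrite invr_gt0 !mulr_gt0// ltr0n.
have e8 : e <= 8^-1.
  rewrite lef_pV2 ?posrE// ?mulr_gt0 ?ltr0n// -mulrA ler_peMr//.
  by rewrite -[leLHS]mulr1 ler_pM.
pose c i : R := nth 0 [seq x 0 j / 2 | j <- enum 'I_n] i.
have cE (i : 'I_n) : c i = x 0 i / 2.
  by rewrite /c (nth_map i) ?size_enum_ord// nth_ord_enum.
have nb : nice n 1 (1 / 2) (fun (_ : unit) s => 1 / 2 * box n c e s).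
  apply: nice_box; last by rewrite divr_ge0.
  move=> i ni; rewrite (cE (Ordinal ni)).
  have := coord_sphere_le1 (Ordinal ni) x1.
  rewrite normrM (ger0_norm (_ : 0 <= 2^-1)) ?invr_ge0// => h.
  lra.
rewrite (_ : _ ^- n = (2 * e) ^+ n); last first.
  by rewrite -exprVn; congr (_ ^+ _); rewrite /e; field; rewrite !pnatr_eq0 -!lt0n n0.
rewrite -(iter_int_box n c (ltW e0)).
have zc : iter_int n (fun s => 1 / 2 * box n c e s) = 1 / 2 * iter_int n (box n c e).
  have nb1 : nice n 1 1 (fun (_ : unit) s => 1 * box n c e s).
    apply: nice_box => // i ni; rewrite (cE (Ordinal ni)).
    have := coord_sphere_le1 (Ordinal ni) x1.
    by rewrite normrM (ger0_norm (_ : 0 <= 2^-1)) ?invr_ge0// => h; lra.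
  have := iter_intZ (1 / 2) tt ler01 nb1.
  have B1 : box n c e = (fun s => 1 * box n c e s) by apply/funext => s; rewrite mul1r.
  rewrite [in X in _ -> X]B1 => <-; apply: iter_int_ext => s _; by rewrite mul1r.
rewrite -zc; apply: (le_iter_int tt ler01 ler01 nb nK) => _ s sn.
have [/forallP h|] := boolP [forall i : 'I_n, `|nth 0 s i - c i| <= e].
  have -> : box n c e s = 1 by rewrite /box big1// => i _; rewrite h.
  have [|ey hy] := @phi_near_half n x (vec_of_seq n s) k n0 x1 k0.
    by move=> i; rewrite vec_of_seq_coord -cE; exact: h.
  by rewrite mulr1 /ballf ey.
rewrite negb_forall => /existsP[i hi].
rewrite /box (bigD1 i)//= (negbTE hi) mul0r mulr0 /ballf.
by case: ifP => // _; exact: ksq_ge0.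
Qed.

End lower_bound.

(** * Polynomial approximation of the kernel *)

Section chebyshev.
Variable R : realType.
Implicit Types (p q : {poly R}) (a t : R).

(** Two consecutive Chebyshev polynomials are carried along, so that the three-term recurrence
    becomes structural. *)
Fixpoint cheb_pair j : {poly R} * {poly R} :=
  if j is j'.+1 then let: (p, q) := cheb_pair j' in (q, 'X * q *+ 2 - p) else (1, 'X).
Definition cheb j : {poly R} := (cheb_pair j).1.

Lemma cheb0 : cheb 0 = 1. Proof. by []. Qed.
Lemma cheb1 : cheb 1 = 'X. Proof. by []. Qed.
Lemma chebSS j : cheb j.+2 = 'X * cheb j.+1 *+ 2 - cheb j.
Proof. by rewrite /cheb /=; case: (cheb_pair j). Qed.

Lemma cheb_ind (P : nat -> Prop) : P 0%N -> P 1%N -> (forall j, P j -> P j.+1 -> P j.+2) ->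
  forall j, P j.
Proof.
move=> P0 P1 PS j; suff: P j /\ P j.+1 by case.
by elim: j => [//|j [Pj Pj1]]; split => //; exact: PS.
Qed.

Lemma size_cheb j : (size (cheb j) <= j.+1)%N.
Proof.
elim/cheb_ind: j => [||j h0 h1]; rewrite ?cheb0 ?cheb1 ?size_poly1 ?size_polyX//.
rewrite chebSS (leq_trans (size_polyD _ _))// geq_max size_polyN; apply/andP; split.
  rewrite mulr2n (leq_trans (size_polyD _ _))// maxnn mulrC.
  by rewrite (leq_trans (size_polyMleq _ _))// size_polyX addn2.
by rewrite (leq_trans h0)// leqW.
Qed.

Lemma cheb_cos j (u : R) : (cheb j).[cos u] = cos (j%:R * u).
Proof.
elim/cheb_ind: j => [||j h0 h1]; rewrite ?cheb0 ?cheb1.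
- by rewrite hornerC mul0r cos0.
- by rewrite hornerX mul1r.
rewrite chebSS hornerD hornerN hornerMn hornerM hornerX h0 h1.
have -> : j.+2%:R * u = j.+1%:R * u + u by rewrite -[j.+2%:R]natr1 mulrDl mul1r.
have -> : j%:R * u = j.+1%:R * u - u by rewrite -[j.+1%:R]natr1 mulrDl mul1r addrK.
rewrite cosB cosD; ring.
Qed.

Lemma cheb_bound j t : -1 <= t <= 1 -> `|(cheb j).[t]| <= 1.
Proof.
by move=> t1; rewrite -(acosK t1) cheb_cos ler_norml cos_geN1 cos_le1.
Qed.

(** The cosine formula with exp(iu) replaced by a positive real a. *)
Lemma cheb_outside j a : 0 < a -> (cheb j).[(a + a^-1) / 2] = (a ^+ j + a ^- j) / 2.
Proof.
move=> a0; have an0 : a != 0 by rewrite gt_eqF.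
elim/cheb_ind: j => [||j h0 h1]; rewrite ?cheb0 ?cheb1.
- by rewrite hornerC expr0 invr1; lra.
- by rewrite hornerX expr1.
rewrite chebSS hornerD hornerN hornerMn hornerM hornerX h0 h1 !exprS.
by field; rewrite an0 expf_neq0.
Qed.

Definition cheb_cone N p := exists2 w : nat -> R, (forall j, 0 <= w j) &
  p = \sum_(j < N.+1) w j *: cheb j.

Lemma cheb_cone_mulX N p : cheb_cone N p -> cheb_cone N.+1 ('X * p).
Proof.
move=> [w w0 ->].
(* From X T_0 = T_1 and X T_j = (T_(j+1) + T_(j-1)) / 2: each weight moves half up and half down,
   except that [w 0] moves up entirely. *)
pose v j : R := (if (0 < j)%N then (if (j.-1 == 0)%N then w 0%N else w j.-1 / 2) else 0)
  + (if (j < N)%N then w j.+1 / 2 else 0).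
exists v.
  move=> j; rewrite /v addr_ge0//; last by case: ifP => // _; rewrite divr_ge0.
  by case: ifP => // _; case: ifP => // _; rewrite divr_ge0.
have mX j : 'X * cheb j.+1 = 2^-1 *: cheb j.+2 + 2^-1 *: cheb j.
  rewrite chebSS -scalerDr subrK -[('X * _) *+ 2]scaler_nat scalerA mulVf ?scale1r//.
rewrite mulr_sumr.
transitivity (\sum_(j < N.+2) (if (0 < j)%N then (if (j.-1 == 0)%N then w 0%N else w j.-1 / 2) else 0) *: cheb j
   + \sum_(j < N.+2) (if (j < N)%N then w j.+1 / 2 else 0) *: cheb j); last first.
  by rewrite -big_split; apply: eq_bigr => j _; rewrite /v scalerDl.
rewrite [X in _ = X + _]big_ord_recl /= scale0r add0r.
rewrite [X in _ = _ + X]big_ord_recr [X in _ = _ + (X + _)]big_ord_recr /= ltnn ltnNge leqnSn /= !scale0r !addr0.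
rewrite big_ord_recl [X in _ = X + _]big_ord_recl /= -scalerAr mulr1 -addrA; congr (_ + _).
rewrite -big_split /=; apply: eq_bigr => j _.
rewrite /bump /= add1n ltn_ord -scalerAr mX scalerDr !scalerA.
by [].
Qed.

Lemma cheb_coneD N p q : cheb_cone N p -> cheb_cone N q -> cheb_cone N (p + q).
Proof.
move=> [w w0 ->] [v v0 ->]; exists (fun j => w j + v j); first by move=> j; rewrite addr_ge0.
by rewrite -big_split; apply: eq_bigr => j _; rewrite scalerDl.
Qed.

Lemma cheb_coneZ N a p : 0 <= a -> cheb_cone N p -> cheb_cone N (a *: p).
Proof.
move=> a0 [w w0 ->]; exists (fun j => a * w j); first by move=> j; rewrite mulr_ge0.
by rewrite scaler_sumr; apply: eq_bigr => j _; rewrite scalerA.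
Qed.

Lemma cheb_coneS N p : cheb_cone N p -> cheb_cone N.+1 p.
Proof.
move=> [w w0 ->]; exists (fun j => if (j < N.+1)%N then w j else 0).
  by move=> j; case: ifP.
rewrite [RHS]big_ord_recr /= ltnn scale0r addr0.
by apply: eq_bigr => j _; rewrite ltn_ord.
Qed.

Lemma cheb_cone_kernel k : cheb_cone k ((2^-1 *: ('X + 1)) ^+ k).
Proof.
elim: k => [|k IH].
  exists (fun=> 1); first by [].
  by rewrite big_ord_recl big_ord0 addr0 scale1r.
rewrite exprS -scalerAl mulrDl mul1r; apply: cheb_coneZ; first by rewrite invr_ge0.
by apply: cheb_coneD; [exact: cheb_cone_mulX|exact: cheb_coneS].
Qed.

(* The Chebyshev coefficients of [((1 + t) / 2) ^ k] are nonnegative, so the tail beyond degree [d] is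
   controlled by the value of the kernel at the point [(a + 1/a) / 2 > 1], where the j-th Chebyshev
   polynomial is at least [a ^ j / 2]. *)
Lemma kernel_approx k d a : 1 <= a -> exists2 p : {poly R}, (size p <= d.+1)%N &
  forall t, -1 <= t <= 1 ->
  `|((t + 1) / 2) ^+ k - p.[t]| <= 2 * a ^- d * (((a + a^-1) / 2 + 1) / 2) ^+ k.
Proof.
move=> a1; have a0 : 0 < a by exact: lt_le_trans a1.
have [w w0 E] := cheb_cone_kernel k.
have hE t : ((t + 1) / 2) ^+ k = \sum_(j < k.+1) w j * (cheb j).[t].
  have : ((2^-1 *: ('X + 1)) ^+ k).[t] = ((t + 1) / 2) ^+ k.
    by rewrite horner_exp hornerZ hornerD hornerX hornerC mulrC.
  move=> <-; rewrite E horner_sum; apply: eq_bigr => j _; exact: hornerZ.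
exists (\sum_(j < k.+1 | (j <= d)%N) w j *: cheb j).
  rewrite (leq_trans (size_sum _ _ _))//; apply/bigmax_leqP => j jd.
  rewrite (leq_trans (size_scale_leq _ _))// (leq_trans (size_cheb _))//.
move=> t t1; rewrite !hE horner_sum (bigID (fun j : 'I_k.+1 => (j <= d)%N))/=.
rewrite (eq_bigr (fun j : 'I_k.+1 => (w j *: cheb j).[t])); last by move=> j _; rewrite hornerZ.
rewrite addrC addrK (le_trans (ler_norm_sum _ _ _))//.
rewrite mulr_sumr [leRHS](bigID (fun j : 'I_k.+1 => (j <= d)%N))/=.
rewrite ler_wpDl//.
  apply: sumr_ge0 => j _; rewrite cheb_outside// !mulr_ge0 ?invr_ge0 ?exprn_ge0 ?(ltW a0)//.
  by rewrite addr_ge0 ?invr_ge0 ?exprn_ge0// ltW.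
(* For j > d the inequality already holds term by term: |T_j(t)| <= 1 <= 2 a^-d T_j((a + 1/a)/2). *)
apply: ler_sum => j; rewrite -ltnNge => dj.
rewrite normrM (ger0_norm (w0 j)) mulrCA ler_wpM2l// (le_trans (cheb_bound j t1))//.
rewrite cheb_outside//.
have -> : forall u v : R, 2 * u * (v / 2) = u * v by move=> u v; field.
rewrite mulrC ler_pdivlMr ?exprn_gt0// mul1r.
rewrite (le_trans (_ : _ <= a ^+ j)) ?ler_weXn2l// ?(ltnW dj)//.
by rewrite lerDl invr_ge0 exprn_ge0// ltW.
Qed.

End chebyshev.

(** * Polynomial functions *)

Section polynomial_functions.
Variables (R : realType) (n d : nat).
Implicit Types (p q : 'rV[R]_n -> R).

Lemma poly_funD p q : poly_fun d p -> poly_fun d q -> poly_fun d (fun y => p y + q y).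
Proof.
move=> [c hc] [c' hc']; exists [ffun a => c a + c' a] => y.
rewrite hc hc' -big_split; apply: eq_bigr => a _.
by rewrite ffunE mulrDl.
Qed.

Lemma poly_funZ a p : poly_fun d p -> poly_fun d (fun y => a * p y).
Proof.
move=> [c hc]; exists [ffun b => a * c b] => y.
by rewrite hc mulr_sumr; apply: eq_bigr => b _; rewrite ffunE mulrA.
Qed.

Lemma poly_fun_cst0 : poly_fun d (fun _ : 'rV[R]_n => 0).
Proof.
exists [ffun=> 0] => y; rewrite big1// => a _; by rewrite ffunE mul0r.
Qed.

Lemma poly_funB p q : poly_fun d p -> poly_fun d q -> poly_fun d (fun y => p y - q y).
Proof.
move=> hp hq; have := poly_funD hp (poly_funZ (-1) hq).
by under eq_fun do rewrite mulN1r.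
Qed.

Lemma poly_fun_sum (I : Type) (r : seq I) (P : pred I) (F : I -> 'rV[R]_n -> R) :
  (forall i, P i -> poly_fun d (F i)) -> poly_fun d (fun y => \sum_(i <- r | P i) F i y).
Proof.
move=> hF; elim: r => [|i r IH].
  by under eq_fun do rewrite big_nil; exact: poly_fun_cst0.
under eq_fun do rewrite big_cons.
by have [/hF Pi|_] := boolP (P i) => //; exact: poly_funD.
Qed.

Lemma poly_fun_monomial (e : 'I_n -> nat) : (\sum_i e i <= d)%N ->
  poly_fun d (fun y : 'rV[R]_n => \prod_i y 0 i ^+ e i).
Proof.
move=> ed; pose a0 : {ffun 'I_n -> 'I_d.+1} := [ffun i => inord (e i)].
have a0E i : a0 i = e i :> nat.
  by rewrite ffunE inordK// ltnS (leq_trans _ ed)// (bigD1 i)//= leq_addr.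
exists [ffun a => (a == a0)%:R] => y.
rewrite (bigD1 a0)/=; last by under eq_bigr do rewrite a0E.
rewrite ffunE eqxx mul1r [X in _ + X]big1 ?addr0.
  by apply: eq_bigr => i _; rewrite a0E.
by move=> a /andP[_ /negbTE aa]; rewrite ffunE aa mul0r.
Qed.

(** The exponents [e] are an accumulator: expanding one factor <x, y> raises one exponent by 1,
    which replaces the multinomial formula. *)
Lemma poly_fun_monomial_dotv (x : 'rV[R]_n) j (e : 'I_n -> nat) : (\sum_i e i + j <= d)%N ->
  poly_fun d (fun y : 'rV[R]_n => (\prod_i y 0 i ^+ e i) * dotv x y ^+ j).
Proof.
elim: j e => [|j IH] e ed.
  by under eq_fun do rewrite expr0 mulr1; apply: poly_fun_monomial; rewrite addn0 in ed.
have : poly_fun d (fun y => \sum_k x 0 k * ((\prod_i y 0 i ^+ (e i + (i == k))) * dotv x y ^+ j)).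
  apply: poly_fun_sum => k _; apply: poly_funZ; apply: IH.
  rewrite big_split/= [X in (_ + X + _)%N](_ : _ = 1)%N; first by rewrite addn1 addSnnS.
  by rewrite (bigD1 k)//= eqxx big1 ?addn0// => i /negbTE ->.
congr poly_fun; apply/funext => y.
rewrite exprS mulrCA [in RHS]/dotv mulr_suml; apply: eq_bigr => k _.
rewrite -mulrA; congr (_ * _); rewrite !mulrA; congr (_ * _).
rewrite (bigD1 k)//= [in RHS](bigD1 k)//= eqxx addn1 exprS -!mulrA; congr (_ * (_ * _)).
by apply: eq_bigr => i /negbTE ->; rewrite addn0.
Qed.

Lemma poly_fun_horner_dotv (x : 'rV[R]_n) (P : {poly R}) : (size P <= d.+1)%N ->
  poly_fun d (fun y => P.[dotv x y]).
Proof.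
move=> sP; under eq_fun do rewrite horner_coef.
apply: poly_fun_sum => j _; apply: poly_funZ.
have := @poly_fun_monomial_dotv x j (fun=> 0%N).
rewrite big1// add0n => /(_ _).
have jd : (j <= d)%N by rewrite -ltnS (leq_trans _ sP).
move=> /(_ jd); under eq_fun do rewrite big1 ?mul1r//.
by [].
Qed.

Lemma adm_poly_fun p : poly_fun d p -> adm p.
Proof.
move=> [c /funext ->].
apply: adm_sum => a _; apply: admZ; apply: adm_prod => i _.
by apply: admX; exact: adm_coord.
Qed.

End polynomial_functions.

(** * Differential calculus of homogeneous functions *)

Section directional.
Variables (R : realType) (n : nat).
Implicit Types (H : 'rV[R]_n -> R) (x y z v : 'rV[R]_n).

(** Passage to one variable, where the mean value theorem and the chain rule apply. *)
Lemma is_derive_line H z v (s d : R) :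
  is_derive (s *: v + z) v H d <-> is_derive s (1 : R) (fun s => H (s *: v + z)) d.
Proof.
have E : (fun h : R => h^-1 *: (((fun s => H (s *: v + z)) \o shift s) (h *: (1 : R)) - H (s *: v + z))) =
  (fun h : R => h^-1 *: ((H \o shift (s *: v + z)) (h *: v) - H (s *: v + z))).
  apply/funext => h /=; congr (_ *: (H _ - _)).
  by rewrite [_%:A]mulr1 scalerDl addrA.
split=> -[d1 <-]; apply: DeriveDef.
- by rewrite /derivable E.
- by rewrite /derive E.
- by rewrite /derivable -E.
- by rewrite /derive -E.
Qed.

Lemma mvt_bound (h dh : R -> R) (K a b : R) :
  (forall s, Num.min a b <= s <= Num.max a b -> is_derive s (1 : R) h (dh s) /\ `|dh s| <= K) ->
  `|h b - h a| <= K * `|b - a|.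
Proof.
wlog ab : a b / a <= b => [W|].
  case/orP: (le_total a b) => [ab|ba] hs; first exact: W.
  rewrite distrC (distrC b); apply: W => // s.
  by rewrite minC maxC; exact: hs.
rewrite min_l// max_r// => hs.
have [||c] := @MVT_segment R h dh a b ab.
- move=> s; rewrite in_itv/= => /andP[as_ sb].
  by have [|//] := hs s; rewrite !ltW.
- apply: derivable_within_continuous => s; rewrite in_itv/= => /hs[[]] //.
rewrite in_itv/= => /hs[_ hc] ->.
by rewrite normrM ler_wpM2r.
Qed.

Lemma coordinate_step H z i (D K : R) :
  (forall s, Num.min 0 D <= s <= Num.max 0 D ->
     derivable H (s *: 'e_i + z) 'e_i /\ `|'D_'e_i H (s *: 'e_i + z)| <= K) ->
  `|H (D *: 'e_i + z) - H z| <= K * `|D|.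
Proof.
move=> h.
have := @mvt_bound (fun s => H (s *: 'e_i + z)) (fun s => 'D_'e_i H (s *: 'e_i + z)) K 0 D.
rewrite scale0r add0r subr0; apply => s /h[d b]; split => //.
exact/is_derive_line/derivableP.
Qed.

(* The path from [x] to [y] changes one coordinate at a time. *)
Lemma lipschitz_box H x y (K : R) :
  (forall z, (forall j, `|z 0 j - x 0 j| <= `|y 0 j - x 0 j|) ->
     forall i, derivable H z 'e_i /\ `|'D_'e_i H z| <= K) ->
  `|H y - H x| <= K * \sum_i `|y 0 i - x 0 i|.
Proof.
move=> hH.
pose p m : 'rV[R]_n := \row_j (if (j < m)%N then y 0 j else x 0 j).
have p0 : p 0%N = x by apply/rowP => j; rewrite mxE.
have pn : p n = y by apply/rowP => j; rewrite mxE ltn_ord.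
suff S m : (m <= n)%N -> `|H (p m) - H x| <= K * \sum_(i < n | (i < m)%N) `|y 0 i - x 0 i|.
  have := S n (leqnn n); rewrite pn; congr (_ <= _ * _).
  by apply: eq_bigl => i; rewrite ltn_ord.
elim: m => [_|m IH mn]; first by rewrite p0 subrr normr0 big_pred0 ?mulr0.
have {}IH := IH (ltnW mn); pose i := Ordinal mn.
have pS : p m.+1 = (y 0 i - x 0 i) *: 'e_i + p m.
  apply/rowP => j; rewrite !mxE eqxx/= ltnS leq_eqVlt.
  have -> : ((j : nat) == m) = (j == i) by [].
  case: eqVneq => [->|ji] /=; first by rewrite ltnn mulr1 subrK.
  by rewrite mulr0 add0r.
have step : `|H (p m.+1) - H (p m)| <= K * `|y 0 i - x 0 i|.
  rewrite pS; apply: coordinate_step => s hs; apply: hH => j.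
  rewrite !mxE eqxx/=; case: eqVneq => [->|ji] /=.
    rewrite ltnn mulr1 addrK.
    move: hs; case/orP: (le_total 0 (y 0 i - x 0 i)) => h0.
      by rewrite min_l// max_r// => /andP[s0 s1]; rewrite !ger0_norm.
    by rewrite min_r// max_l// => /andP[s0 s1]; rewrite !ler0_norm// lerN2.
  by rewrite mulr0 add0r; case: ifP => // _; rewrite subrr normr0.
have -> : \sum_(j < n | (j < m.+1)%N) `|y 0 j - x 0 j| =
    `|y 0 i - x 0 i| + \sum_(j < n | (j < m)%N) `|y 0 j - x 0 j|.
  rewrite (bigD1 i)//=; congr (_ + _); apply: eq_bigl => j; rewrite ltnS leq_eqVlt.
  have -> : (j == i) = ((j : nat) == m) by [].
  by case: eqP => [->|_]; rewrite ?ltnn ?andbF ?andbT.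
rewrite mulrDr (_ : H _ - H x = (H (p m.+1) - H (p m)) + (H (p m) - H x)); last by ring.
by apply: (le_trans (ler_normD _ _)); exact: lerD.
Qed.

(** Along the line, H(s v + r z) = c H((s/r) v + z), and the chain rule contributes 1/r. The
    equality is used only for s near 0, where a nonzero coordinate of z keeps the point off the
    origin. *)
Lemma derive_homogeneous H (r c : R) z v : 0 < r -> z != 0 ->
  (forall y, y != 0 -> H (r *: y) = c * H y) -> derivable H z v ->
  derivable H (r *: z) v /\ 'D_v H (r *: z) = c / r * 'D_v H z.
Proof.
move=> r0 z0 hom dH.
have r0' : r != 0 by rewrite gt_eqF.
have [i zi] : exists i, z 0 i != 0.
  apply/existsP; apply: contraNT z0; rewrite negb_exists => /forallP h.
  by apply/eqP/rowP => i; rewrite mxE; have := h i; rewrite negbK => /eqP.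
have d1 : is_derive ((fun s : R => s / r) 0) (1 : R) (fun s => H (s *: v + z)) ('D_v H z).
  rewrite mul0r; apply/is_derive_line; rewrite scale0r add0r; exact: derivableP.
have d2 : is_derive (0 : R) (1 : R) (fun s : R => s / r) r^-1.
  rewrite (_ : (fun s : R => _) = r^-1 *: (@id R)); last by apply/funext => s; rewrite mulrC.
  by apply: is_derive_eq; rewrite [_%:A]mulr1.
have d3 := @is_derive1_comp R (fun s => H (s *: v + z)) (fun s : R => s / r) 0 _ _ d1 d2.
have d4 : is_derive (0 : R) (1 : R) (c *: ((fun s => H (s *: v + z)) \o (fun s : R => s / r))) (c *: ('D_v H z * r^-1)).
  by apply: is_deriveZ.
suff d5 : is_derive (0 : R) (1 : R) (fun s => H (s *: v + r *: z)) (c *: ('D_v H z * r^-1)).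
  move/is_derive_line: d5; rewrite scale0r add0r => -[dd ->]; split => //.
  by rewrite /GRing.scale/=; ring.
apply: near_eq_is_derive d4.
have ct : (fun s : R => s / r * v 0 i + z 0 i) s @[s --> (0 : R)] --> (0 : R) / r * v 0 i + z 0 i.
  apply: cvgD; last exact: cvg_cst.
  by apply: cvgM; [apply: cvgM; [exact: cvg_id|exact: cvg_cst]|exact: cvg_cst].
have ct0 : (0 : R) / r * v 0 i + z 0 i != 0 by rewrite !mul0r add0r.
near=> s.
have sz : (s / r) *: v + z != 0.
  apply/eqP => /rowP/(_ i); rewrite !mxE; apply/eqP.
  by near: s; exact: cvgr_neq0 ct ct0.
have := hom _ sz; rewrite scalerDr scalerA mulrCA mulfV// mulr1 => ->.
by [].
Unshelve. all: by end_near. Qed.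

End directional.

(** * Lipschitz and Taylor estimates on the sphere *)

Section sphere_calculus.
Variables (R : realType) (n : nat).
Implicit Types (x y z : 'rV[R]_n).

Lemma box_enorm x y z : (forall j, `|z 0 j - x 0 j| <= `|y 0 j - x 0 j|) ->
  enorm (z - x) <= enorm (y - x).
Proof.
move=> h; rewrite /enorm ler_sqrt ?dotv_ge0//; apply: ler_sum => j _.
rewrite -!expr2 -[leLHS]real_normK ?num_real// -[leRHS]real_normK ?num_real//.
by rewrite ler_sqr ?nnegrE// !mxE h.
Qed.

Lemma enormN x : enorm (- x) = enorm x.
Proof. by rewrite -scaleN1r enormZ normrN1 mul1r. Qed.

Lemma enorm_sub_ge x z : enorm x - enorm (z - x) <= enorm z.
Proof.
by rewrite lerBlDr -{1}(subrK z x) addrC -(enormN (z - x)) opprB enormD.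
Qed.

Lemma sum_coord_le_enorm x : \sum_i `|x 0 i| <= n%:R * enorm x.
Proof.
rewrite (@le_trans _ _ (\sum_(i < n) enorm x))//.
  by apply: ler_sum => i _; exact: coord_le_enorm.
by rewrite sumr_const card_ord mulr_natl.
Qed.

(** Within |x|/2 of x all points have norm at least |x|/2, so the singular bound K/|z|^m becomes
    uniform. The case m = 1 serves the extension of g, and m = 2 its first partial derivatives. *)
Lemma lipschitz_away_from0 (H : 'rV[R]_n -> R) (K : R) m x y : x != 0 ->
  (forall z, z != 0 -> forall i, derivable H z 'e_i /\ `|'D_'e_i H z| <= K / enorm z ^+ m) ->
  enorm (y - x) <= enorm x / 2 -> 0 <= K ->
  `|H y - H x| <= K * (2 / enorm x) ^+ m * (n%:R * enorm (y - x)).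
Proof.
move=> x0 hH yx K0.
have ex : 0 < enorm x by rewrite enorm_gt0.
have KK : 0 <= K * (2 / enorm x) ^+ m by rewrite mulr_ge0// exprn_ge0// divr_ge0// ltW.
apply: (@le_trans _ _ (K * (2 / enorm x) ^+ m * \sum_i `|y 0 i - x 0 i|)); last first.
  rewrite ler_wpM2l// (le_trans _ (sum_coord_le_enorm _))//.
  by apply: ler_sum => i _; rewrite !mxE.
apply: lipschitz_box => z /box_enorm zx i.
have ez : enorm x / 2 <= enorm z by have := enorm_sub_ge x z; lra.
have ez0 : 0 < enorm z by lra.
have z0 : z != 0 by rewrite -enorm_gt0.
have [d b] := hH z z0 i; split => //; apply: (le_trans b).
rewrite ler_wpM2l// -exprVn lerXn2r ?nnegrE ?invr_ge0 ?divr_ge0 ?(ltW ez0) ?(ltW ex)//.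
by rewrite -[2 / _]invrK invf_div lef_pV2 ?posrE// divr_gt0.
Qed.

Variable g : 'rV[R]_n -> R.
Local Notation G := (hom_ext g).

Lemma hom_extZ (r : R) y : 0 < r -> G (r *: y) = G y.
Proof. by move=> r0; rewrite /hom_ext radialZ. Qed.

Lemma enorm_radialK z : z != 0 -> enorm z *: radial z = z.
Proof. by move=> z0; rewrite /radial scalerA mulfV ?scale1r// gt_eqF// enorm_gt0. Qed.

(** The extension is homogeneous of degree 0, so its partial derivatives have degree -1 and their
    bound on the sphere spreads with a factor 1/|z|. *)
Lemma partial_bound (L : R) : C1_sphere g L -> forall z, z != 0 -> forall i,
  derivable G z 'e_i /\ `|'D_'e_i G z| <= `|L| / enorm z ^+ 1.
Proof.
move=> [dG bG] z z0 i; have [d _] := dG z z0 i; split => //.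
have ez0 : 0 < enorm z by rewrite enorm_gt0.
have sz := dotv_radial z0.
have r0 := sphere_neq0 sz.
have [||_] := @derive_homogeneous R n G (enorm z) 1 (radial z) 'e_i ez0 r0.
- by move=> y _; rewrite hom_extZ// mul1r.
- by case: (dG _ r0 i).
rewrite enorm_radialK// => ->; rewrite mul1r normrM gtr0_norm ?invr_gt0// expr1 mulrC.
by rewrite ler_wpM2r ?invr_ge0 ?(ltW ez0)// (le_trans (bG _ i sz))// ler_norm.
Qed.

Lemma partial_homogeneous (L : R) i : C1_sphere g L -> forall (r : R) y, 0 < r -> y != 0 ->
  'D_'e_i G (r *: y) = r^-1 * 'D_'e_i G y.
Proof.
move=> [dG _] r y r0 y0.
have [||_ ->] := @derive_homogeneous R n G r 1 y 'e_i r0 y0; last by rewrite mul1r.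
- by move=> z _; rewrite hom_extZ// mul1r.
- by case: (dG _ y0 i).
Qed.

Lemma second_partial_bound (L1 L2 : R) : C2_sphere g L1 L2 -> forall i z, z != 0 -> forall j,
  derivable (fun z => 'D_'e_i G z) z 'e_j /\
  `|'D_'e_j (fun w => 'D_'e_i G w) z| <= `|L2| / enorm z ^+ 2.
Proof.
move=> [C1 [dG bG]] i z z0 j; have [d _] := dG z z0 i j; split => //.
have ez0 : 0 < enorm z by rewrite enorm_gt0.
have sz := dotv_radial z0.
have r0 := sphere_neq0 sz.
have [||_] := @derive_homogeneous R n (fun w => 'D_'e_i G w) (enorm z) (enorm z)^-1 (radial z) 'e_j ez0 r0.
- by move=> y y0; rewrite (partial_homogeneous i C1).
- by case: (dG _ r0 i j).
rewrite enorm_radialK// => ->; rewrite -expr2 normrM exprVn.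
rewrite gtr0_norm ?invr_gt0 ?exprn_gt0// mulrC.
by rewrite ler_wpM2r ?invr_ge0 ?exprn_ge0 ?(ltW ez0)// (le_trans (bG _ i j sz))// ler_norm.
Qed.

(** Partial derivatives alone do not give continuity; the local Lipschitz estimate drawn from their
    bound does. Measurability of 1/f and of f will come from here. *)
Lemma C1_sphere_continuous (L : R) : C1_sphere g L -> forall y, y != 0 -> {for y, continuous G}.
Proof.
move=> C1 y y0; have ey : 0 < enorm y by rewrite enorm_gt0.
pose K := `|L| * (2 / enorm y) ^+ 1 * n%:R + 1.
have K0 : 0 < K.
  by rewrite /K expr1 ltr_wpDl// !mulr_ge0// invr_ge0 ltW.
have ce : (fun z => enorm (z - y)) z @[z --> y] --> (0 : R).
  have c1 : {for y, continuous (fun z : 'rV[R]_n => z - y)}.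
    exact: (@continuousB _ _ _ (@id 'rV[R]_n) (fun=> y) y cvg_id (@cst_continuous _ _ y y)).
  have e00 : enorm (y - y) = 0.
    by apply/eqP; rewrite eq_le enorm_ge0 andbT leNgt enorm_gt0 subrr eqxx.
  rewrite -e00; exact: (continuous_cvg _ (@continuous_enorm R n (y - y)) c1).
apply/(@cvgrPdist_lt _ _ _ (nbhs y) _ G (G y)) => e e0; near=> z.
have h1 : enorm (z - y) < enorm y / 2.
  near: z; apply: (cvgr_lt _ ce); by rewrite divr_gt0.
have h2 : enorm (z - y) < e / K.
  near: z; apply: (cvgr_lt _ ce); by rewrite divr_gt0.
rewrite distrC (le_lt_trans (lipschitz_away_from0 y0 (partial_bound C1) (ltW h1) _))//.
apply: (@le_lt_trans _ _ (K * enorm (z - y))).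
  by rewrite mulrA ler_wpM2r ?enorm_ge0// lerDl.
by rewrite mulrC -ltr_pdivlMr.
Unshelve. all: by end_near. Qed.

Lemma hom_ext_sphere x : dotv x x = 1 -> G x = g x.
Proof. by move=> x1; rewrite /hom_ext sphere_radial. Qed.

(** The path between distant points, such as antipodes, may meet the origin, where the extension is
    singular. So the derivative bound is used up to distance 1/2, and beyond it the oscillation
    satisfies B <= 2B |y - x|. *)
Lemma sphere_lipschitz (L B : R) : C1_sphere g L ->
  (forall x y, dotv x x = 1 -> dotv y y = 1 -> `|g y - g x| <= B) ->
  forall x y, dotv x x = 1 -> dotv y y = 1 ->
  `|g y - g x| <= (2 * `|L| * n%:R + 2 * B) * enorm (y - x).
Proof.
move=> C1 hB x y x1 y1.
have ex : enorm x = 1 by rewrite /enorm x1 sqrtr1.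
have B0 : 0 <= B by exact: le_trans (hB x y x1 y1).
have e0 := enorm_ge0 (y - x).
have [h|h] := leP (enorm (y - x)) (1 / 2).
  have := @lipschitz_away_from0 G `|L| 1 x y (sphere_neq0 x1) (partial_bound C1).
  rewrite ex !hom_ext_sphere// => /(_ h (normr_ge0 _)) /le_trans; apply.
  rewrite expr1 divr1 mulrDl (mulrC `|L|) mulrA.
  by rewrite lerDl mulr_ge0// mulr_ge0.
apply: le_trans (hB x y x1 y1) _.
rewrite mulrDl ler_wpDl//; first by rewrite !mulr_ge0.
by rewrite mulrAC ler_peMl//; lra.
Qed.

Lemma is_derive_dotv (a z v : 'rV[R]_n) : is_derive z v (dotv a) (dotv a v).
Proof.
suff : is_derive (0 *: v + z) v (dotv a) (dotv a v) by rewrite scale0r add0r.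
apply/is_derive_line.
rewrite (_ : (fun s : R => _) = dotv a v *: (@id R) + cst (dotv a z)).
  by apply: is_derive_eq; rewrite addr0 [_%:A]mulr1.
by apply/funext => s; rewrite dotvDr dotvZr mulrC.
Qed.

(** The vector a is the gradient of the extension at x. At distance e <= 1/2, the partial
    derivatives of G - <a, .> are at most 4 |L2| n e, and summing over a coordinate path gives n e
    more. For e > 1/2, the inequalities 1 <= 4 e^2 and e <= 2 e^2 absorb the oscillation and the
    linear term. *)
Lemma sphere_taylor (L1 L2 B : R) : C2_sphere g L1 L2 ->
  (forall x y, dotv x x = 1 -> dotv y y = 1 -> `|g y - g x| <= B) ->
  forall x, dotv x x = 1 -> exists2 a : 'rV[R]_n, (forall i, `|a 0 i| <= `|L1|) &
  forall y, dotv y y = 1 -> `|g y - g x - dotv a (y - x)| <=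
    (4 * `|L2| * n%:R ^+ 2 + 4 * B + 2 * `|L1| * n%:R) * enorm (y - x) ^+ 2.
Proof.
move=> C2 hB x x1; have C1 := C2.1.
have ex : enorm x = 1 by rewrite /enorm x1 sqrtr1.
have x0 := sphere_neq0 x1.
pose a : 'rV[R]_n := \row_i 'D_'e_i G x.
have aL i : `|a 0 i| <= `|L1|.
  by rewrite mxE; have [_] := partial_bound C1 x0 i; rewrite ex expr1 divr1.
exists a => // y y1.
have B0 : 0 <= B by exact: le_trans (hB x y x1 y1).
have e0 := enorm_ge0 (y - x).
set e := enorm (y - x) in e0 *.
have n2 : 0 <= n%:R ^+ 2 :> R by rewrite exprn_ge0.
have [h|h] := leP e (1 / 2).
  pose H z := G z - dotv a z.
  have HL : `|H y - H x| <= 4 * `|L2| * (n%:R * e) * \sum_i `|y 0 i - x 0 i|.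
    apply: lipschitz_box => z /box_enorm zx i.
    have z0 : z != 0.
      by rewrite -enorm_gt0; have := enorm_sub_ge x z; rewrite ex; move: zx h; rewrite -/e; lra.
    have [d1 _] := partial_bound C1 z0 i.
    have dH : is_derive z 'e_i H ('D_'e_i G z - a 0 i).
      rewrite -(dotv_ei a i).
      exact: (is_deriveB (derivableP d1) (is_derive_dotv a z 'e_i)).
    split; first by case: dH.
    rewrite (@derive_val _ _ _ _ _ _ _ dH) mxE.
    have := @lipschitz_away_from0 (fun w => 'D_'e_i G w) `|L2| 2 x z x0 (second_partial_bound C2 i).
    rewrite ex => /(_ (le_trans zx h) (normr_ge0 _)) /le_trans; apply.
    rewrite divr1 (_ : 2 ^+ 2 = 4); last by ring.
    rewrite (mulrC `|L2|) ler_wpM2l ?mulr_ge0// ler_wpM2l//.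
  have -> : g y - g x - dotv a (y - x) = H y - H x.
    by rewrite /H !hom_ext_sphere// dotvDr dotvNr; ring.
  apply: (le_trans HL); apply: (@le_trans _ _ (4 * `|L2| * (n%:R * e) * (n%:R * e))).
    rewrite ler_wpM2l ?mulr_ge0// (le_trans _ (sum_coord_le_enorm _))//.
    by apply: ler_sum => i _; rewrite !mxE.
  rewrite (_ : 4 * `|L2| * (n%:R * e) * (n%:R * e) = 4 * `|L2| * n%:R ^+ 2 * e ^+ 2); last by ring.
  rewrite ler_wpM2r ?exprn_ge0// -addrA lerDl addr_ge0 ?mulr_ge0//.
have e2 : e <= 2 * e ^+ 2 by rewrite expr2 mulrA ler_peMl//; lra.
have e4 : 1 <= 4 * e ^+ 2.
  have : 1 / 2 * (1 / 2) <= e * e by rewrite ler_pM//; lra.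
  rewrite expr2; lra.
have da : `|dotv a (y - x)| <= `|L1| * (n%:R * e).
  rewrite (le_trans (ler_norm_sum _ _ _))// (@le_trans _ _ (\sum_i `|L1| * `|(y - x) 0 i|))//.
    by apply: ler_sum => i _; rewrite normrM ler_wpM2r.
  by rewrite -mulr_sumr ler_wpM2l// sum_coord_le_enorm.
rewrite (le_trans (ler_normB _ _))// (le_trans (lerD (hB x y x1 y1) da))//.
rewrite 2!mulrDl -addrA ler_wpDl ?mulr_ge0 ?exprn_ge0// lerD//.
  by rewrite -mulrA mulrCA ler_peMr.
rewrite (_ : 2 * `|L1| * n%:R * e ^+ 2 = `|L1| * n%:R * (2 * e ^+ 2)); last by ring.
by rewrite mulrA ler_wpM2l// mulr_ge0.
Qed.

End sphere_calculus.

(** * Rates in terms of the degree *)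

Section scales.
Variable R : realType.

Lemma powR_cbrt (d m : nat) : (d%:R : R) `^ (m%:R / 3) = (d%:R `^ 3^-1) ^+ m.
Proof. by rewrite mulrC powRrM powR_mulrn// powR_ge0. Qed.

Lemma cbrt_ge1 (d : nat) : (0 < d)%N -> 1 <= (d%:R : R) `^ 3^-1.
Proof.
move=> d0; rewrite -[leLHS](powRr0 (d%:R : R)).
by apply: ler_powR; rewrite ?ler1n ?invr_ge0.
Qed.

(** Since r^4 >= 1, truncation leaves k >= 1, whence r^4 < k + 1 <= 2k. *)
Lemma kdeg_bounds (d : nat) : (0 < d)%N ->
  let r := (d%:R : R) `^ 3^-1 in
  [/\ (0 < kdeg R d)%N, (kdeg R d)%:R <= r ^+ 4 & r ^+ 4 <= 2 * (kdeg R d)%:R].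
Proof.
move=> d0 r; have r1 : 1 <= r by exact: cbrt_ge1.
have r4 : 1 <= r ^+ 4 by rewrite exprn_ege1.
have kE : kdeg R d = Num.truncn (r ^+ 4) by rewrite /kdeg -(powR_cbrt d 4).
have /andP[h1 h2] : (kdeg R d)%:R <= r ^+ 4 < (kdeg R d).+1%:R.
  by rewrite kE; apply: truncn_itv; apply: le_trans r4.
have k0 : (0 < kdeg R d)%N.
  by rewrite lt0n; apply/negP => /eqP k0; move: h2; rewrite k0; lra.
split => //; have : 1 <= (kdeg R d)%:R :> R by rewrite ler1n.
by move: h2; rewrite -natr1; lra.
Qed.

Lemma expR_ge_pow (u : R) N : 0 <= u -> (0 < N)%N -> (u / N%:R) ^+ N <= expR u.
Proof.
move=> u0 N0; have N0' : N%:R != 0 :> R by rewrite pnatr_eq0 -lt0n.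
have -> : expR u = expR (u / N%:R) ^+ N by rewrite -expRM_natl mulrC divfK.
rewrite lerXn2r ?nnegrE ?expR_ge0 ?divr_ge0//.
by apply: le_trans (expR_ge1Dx _); rewrite lerDr.
Qed.

(** With e = r^-2 and a = 1 + e, the kernel base at (a + 1/a)/2 is at most 1 + e^2, and k e^2 <= 1
    bounds its k-th power by [expR 1]. Moreover a^d >= exp(r/2), which exceeds (r/(2N))^N for every
    N. *)
Lemma kernel_approx_scale (d N : nat) : (0 < d)%N -> (0 < N)%N ->
  let r := (d%:R : R) `^ 3^-1 in
  exists2 p : {poly R}, (size p <= d.+1)%N & forall t, -1 <= t <= 1 ->
   `|((t + 1) / 2) ^+ kdeg R d - p.[t]| <= 2 * expR 1 * (2 * N%:R / r) ^+ N.
Proof.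
move=> d0 N0 r; have r1 : 1 <= r by exact: cbrt_ge1.
have r0 : 0 < r by exact: lt_le_trans r1.
have [_ kr _] := kdeg_bounds d0; rewrite -/r in kr.
set k := kdeg R d in kr *.
have dr : d%:R = r ^+ 3 by rewrite -powR_cbrt divff ?powRr1.
pose e := r ^- 2; have e0 : 0 < e by rewrite invr_gt0 exprn_gt0.
have e1 : e <= 1 by rewrite invf_le1 ?exprn_gt0// exprn_ege1.
have a1 : 1 <= 1 + e by rewrite lerDl ltW.
have a0 : 0 < 1 + e by rewrite addr_gt0.
have [p sp hp] := kernel_approx k d a1.
exists p => // t t1; apply: le_trans (hp t t1) _.
have h1 : (1 + e) ^- d <= (2 * N%:R / r) ^+ N.
  rewrite -[_ / r]invrK invf_div exprVn lef_pV2 ?posrE ?exprn_gt0// ?divr_gt0 ?mulr_gt0 ?ltr0n//.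
  (* Equivalent to 1/(1 + e) <= exp(-e/2), which follows from 1 - e/2 <= exp(-e/2) as e <= 1. *)
  have ee : expR (e / 2) <= 1 + e.
    rewrite -[leLHS]invrK -expRN -[leRHS]invrK lef_pV2 ?posrE ?expR_gt0 ?invr_gt0//.
    apply: le_trans (expR_ge1Dx _).
    rewrite -div1r ler_pdivrMr//.
    have : e * e <= e by rewrite ler_piMl// ltW.
    lra.
  apply: (@le_trans _ _ (expR (e / 2) ^+ d)); last by rewrite lerXn2r// nnegrE ?expR_ge0// ltW.
  rewrite -expRM_natl dr.
  have -> : r ^+ 3 * (e / 2) = r / 2 by rewrite /e; field; rewrite gt_eqF.
  apply: le_trans (expR_ge_pow (_ : 0 <= r / 2) N0); last by rewrite divr_ge0// ltW.
  by rewrite invfM mulrA.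
have h2 : (((1 + e + (1 + e)^-1) / 2 + 1) / 2) ^+ k <= expR 1.
  have b1 : ((1 + e + (1 + e)^-1) / 2 + 1) / 2 <= 1 + e ^+ 2.
    have -> : ((1 + e + (1 + e)^-1) / 2 + 1) / 2 = 1 + e ^+ 2 / (4 * (1 + e)) by field; rewrite gt_eqF.
    rewrite lerD2l ler_pdivrMr ?mulr_gt0// ler_peMr ?sqr_ge0//; lra.
  have b0 : 0 <= ((1 + e + (1 + e)^-1) / 2 + 1) / 2.
    by rewrite divr_ge0// addr_ge0// divr_ge0// addr_ge0 ?invr_ge0// ltW.
  apply: (@le_trans _ _ (expR (e ^+ 2) ^+ k)).
    by rewrite lerXn2r ?nnegrE ?expR_ge0// (le_trans b1)// expR_ge1Dx.
  rewrite -expRM_natl ler_expR /e -exprVn -exprM exprVn ler_pdivrMr ?exprn_gt0// mul1r.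
  exact: kr.
rewrite -[leLHS]mulrA -[leRHS]mulrA ler_wpM2l// [leRHS]mulrC ler_pM ?invr_ge0 ?exprn_ge0//.
- exact: ltW.
- by rewrite divr_ge0// addr_ge0// divr_ge0// addr_ge0 ?invr_ge0// ltW.
Qed.

End scales.

(** * Orthogonal projection and its error *)

Section projection_error.
Variables (R : realType) (n : nat) (f : 'rV[R]_n -> R) (m M : R).
Hypotheses (m0 : 0 < m) (fS : forall y, dotv y y = 1 -> m <= f y <= M).
Local Notation g := (fun y => (f y)^-1).

Lemma density_gt0 y : dotv y y = 1 -> 0 < f y.
Proof. by move=> /fS/andP[+ _]; exact: lt_le_trans. Qed.

Lemma inv_density_bounds y : dotv y y = 1 -> 0 < g y <= m^-1.
Proof.
move=> y1; have f0 := density_gt0 y1; rewrite invr_gt0 f0 lef_pV2 ?posrE//.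
by case/andP: (fS y1).
Qed.

Lemma inv_density_osc x y : dotv x x = 1 -> dotv y y = 1 -> `|g y - g x| <= m^-1.
Proof.
move=> /inv_density_bounds/andP[? ?] /inv_density_bounds/andP[? ?].
by rewrite ler_norml; apply/andP; split; lra.
Qed.

Hypothesis cG : forall y, y != 0 -> {for y, continuous (hom_ext g)}.

Lemma adm_inv_density : adm g.
Proof.
apply: (@adm_continuous _ _ _ m^-1) => // y /inv_density_bounds/andP[h1 h2].
by rewrite gtr0_norm.
Qed.

(** Measurability of [f] is inherited from its inverse, whose extension is continuous and positive
    off the origin. *)
Lemma adm_density : adm f.
Proof.
apply: (@adm_continuous _ _ _ M) => [y y0|y y1]; last first.
  by rewrite gtr0_norm ?density_gt0//; case/andP: (fS y1).
have g0 : hom_ext g y != 0.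
  by rewrite gt_eqF// invr_gt0; apply: density_gt0; exact: dotv_radial.
have := continuousV g0 (cG y0).
rewrite (_ : (fun z => f (radial z)) = (fun z => (hom_ext g z)^-1))//.
by apply/funext => z; rewrite /hom_ext invrK.
Qed.

Variables (x : 'rV[R]_n) (d k : nat) (p : 'rV[R]_n -> R).
Hypotheses (x1 : dotv x x = 1) (k0 : (0 < k)%N).
Hypothesis (hp : is_proj d f (fun y => phi x k y / f y) p).
Local Notation h := (fun y => phi x k y / f y).
Local Notation W := (ksq x k).

Lemma sphere_dim_gt0 : (0 < n)%N.
Proof.
rewrite lt0n; apply/eqP => n0; have := oner_neq0 R; rewrite -x1 /dotv big1 ?eqxx// => i _.
by have := ltn_ord i; rewrite [X in (_ < X)%N]n0.
Qed.

Lemma ball_int_ksq_gt0 : 0 < ball_int W.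
Proof.
apply: lt_le_trans (ball_int_ksq_lower sphere_dim_gt0 x1 k0).
by rewrite mulr_gt0 ?divr_gt0 ?invr_gt0 ?exprn_gt0 ?mulr_gt0 ?ltr0n ?sphere_dim_gt0.
Qed.

Lemma ksq_le1 y : dotv y y = 1 -> W y <= 1.
Proof.
move=> y1; have /andP[a b] := dotv_sphere_itv x1 y1.
by rewrite /ksq /phi -exprM exprn_ile1//; lra.
Qed.

(** The volume dominates the mass of the kernel, already known to be positive. It makes the
    normalization of [sph_int] a genuine division. *)
Lemma ball_volume_gt0 : 0 < ball_int (fun _ : 'rV[R]_n => 1).
Proof.
apply: lt_le_trans ball_int_ksq_gt0 _; apply: ball_int_le; first exact: sphere_dim_gt0.
- exact: adm_ksq.
- exact: adm_cst.
- exact: ksq_le1.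
Qed.

Lemma adm_quotient : adm h.
Proof. apply: admM; [exact: adm_phi|exact: adm_inv_density]. Qed.

Lemma adm_proj : adm p.
Proof. by apply: adm_poly_fun; exact: hp.1. Qed.

Lemma proj_orthogonal q : poly_fun d q -> ball_int (fun y => (h y - p y) * q y * f y) = 0.
Proof.
move=> /(hp.2)/eqP; rewrite /mu_inner sph_intE mulf_eq0 invr_eq0.
by rewrite (gt_eqF ball_volume_gt0) orbF => /eqP.
Qed.

Lemma ghat_ball_int : ghat f p x k = ball_int (fun y => p y * p y * f y) / ball_int W.
Proof.
rewrite /ghat /mu_inner !sph_intE.
set a := ball_int _; set V := ball_int _; set b := ball_int _.
have V0 : V != 0 by rewrite gt_eqF// ball_volume_gt0.
have b0 : b != 0 by rewrite gt_eqF// ball_int_ksq_gt0.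
by rewrite invf_div mulrA divfK.
Qed.

Lemma ball_int_proj_sq : ball_int (fun y => p y * p y * f y) =
  ball_int (fun y => W y * g y) - ball_int (fun y => (h y - p y) ^+ 2 * f y).
Proof.
have ah := adm_quotient; have ap := adm_proj; have af := adm_density.
have ag := adm_inv_density; have aW := adm_ksq x k.
have ahp : adm (fun y => h y - p y) by exact: admB.
have a1 : adm (fun y => W y * g y) by exact: admM.
have a2 : adm (fun y => (h y - p y) ^+ 2 * f y) by apply: admM => //; exact: admX.
have a3 : adm (fun y => (h y - p y) * p y * f y) by apply: admM => //; exact: admM.
have a4 : adm (fun y => p y * p y * f y) by apply: admM => //; exact: admM.
have o := proj_orthogonal hp.1.
have o2 : ball_int (fun y => 2 * ((h y - p y) * p y * f y)) = 0 by rewrite (ball_intZ 2 a3) o mulr0.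
rewrite -[RHS]subr0 -[in RHS]o2 -(ball_intB a1 a2) -(ball_intB (admB a1 a2) (admZ 2 a3)).
apply: (ball_int_eq sphere_dim_gt0 a4 (admB (admB a1 a2) (admZ 2 a3))) => y y1.
by rewrite /ksq; field; rewrite gt_eqF// density_gt0.
Qed.

Lemma proj_minimal q : poly_fun d q ->
  ball_int (fun y => (h y - p y) ^+ 2 * f y) <= ball_int (fun y => (h y - q y) ^+ 2 * f y).
Proof.
move=> hq; have ah := adm_quotient; have ap := adm_proj; have af := adm_density.
have aq := adm_poly_fun hq.
have ahp : adm (fun y => h y - p y) by exact: admB.
have apq : adm (fun y => p y - q y) by exact: admB.
have a2 : adm (fun y => (h y - p y) ^+ 2 * f y) by apply: admM => //; exact: admX.
have a3 : adm (fun y => (h y - p y) * (p y - q y) * f y) by apply: admM => //; exact: admM.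
have a4 : adm (fun y => (h y - q y) ^+ 2 * f y) by apply: admM => //; apply: admX; exact: admB.
have o := proj_orthogonal (poly_funB hp.1 hq).
have o2 : ball_int (fun y => 2 * ((h y - p y) * (p y - q y) * f y)) = 0 by rewrite (ball_intZ 2 a3) o mulr0.
rewrite -[leLHS]addr0 -[in leLHS]o2 -(ball_intD a2 (admZ 2 a3)).
apply: (ball_int_le sphere_dim_gt0 (admD a2 (admZ 2 a3)) a4) => y y1.
rewrite -subr_ge0 (_ : _ - _ = (p y - q y) ^+ 2 * f y); last by ring.
by rewrite mulr_ge0 ?sqr_ge0// ltW// density_gt0.
Qed.

(** The two sources of error are separated: averaging g against the kernel, and projecting.
    Minimality lets any competitor [q] replace the projection in the second. *)
Lemma ghat_error q : poly_fun d q ->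
  `|ghat f p x k - g x| <= (`|ball_int (fun y => W y * (g y - g x))| +
     ball_int (fun y => (h y - q y) ^+ 2 * f y)) / ball_int W.
Proof.
move=> hq; have W0 := ball_int_ksq_gt0.
have ag := adm_inv_density; have aW := adm_ksq x k.
have a1 : adm (fun y => W y * g y) by exact: admM.
have E : ball_int (fun y => W y * (g y - g x)) = ball_int (fun y => W y * g y) - g x * ball_int W.
  rewrite -(ball_intZ (g x) aW) -(ball_intB a1 (admZ (g x) aW)).
  by congr ball_int; apply/funext => y; ring.
have ah := adm_quotient; have ap := adm_proj; have af := adm_density.
have I0 : 0 <= ball_int (fun y => (h y - p y) ^+ 2 * f y).
  rewrite -(ball_int_0 R n); apply: (ball_int_le sphere_dim_gt0); first exact: adm_cst.
    by apply: admM => //; apply: admX; exact: admB.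
  by move=> y y1; rewrite mulr_ge0 ?sqr_ge0// ltW// density_gt0.
have := proj_minimal hq; move: I0; set I := ball_int _ => I0 hI.
rewrite ghat_ball_int ball_int_proj_sq -/I ler_pdivlMr// -[X in _ * X <= _](gtr0_norm W0) -normrM mulrBl divfK ?gt_eqF//.
rewrite addrAC -E (le_trans (ler_normB _ _))// lerD2l (ger0_norm I0)//.
Qed.

(** Splitting h - g(x) P as u + v with u = phi (g - g(x)) and v = g(x) (phi - P), one uses (u + v)^2
    <= 2u^2 + 2v^2. The 4 is this 2 times the 2 of |y - x|^2 = 2 (1 - <x, y>), and M bounds f. *)
Lemma approx_error (Lc eps : R) (P : {poly R}) : 0 <= Lc ->
  (forall y, dotv y y = 1 -> `|g y - g x| <= Lc * enorm (y - x)) ->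
  (forall t, -1 <= t <= 1 -> `|((t + 1) / 2) ^+ k - P.[t]| <= eps) ->
  (size P <= d.+1)%N ->
  ball_int (fun y => (h y - g x * P.[dotv x y]) ^+ 2 * f y) <=
    4 * M * Lc ^+ 2 * (n%:R / (2 * k%:R) * ball_int W) +
    2 * M * m^-1 ^+ 2 * eps ^+ 2 * ball_int (fun _ : 'rV[R]_n => 1).
Proof.
move=> Lc0 gL hP sP; have n0 := sphere_dim_gt0.
have af := adm_density; have ah := adm_quotient; have aW := adm_ksq x k.
have M0 : 0 <= M by case/andP: (fS x1) => h1 h2; apply: ltW; apply: lt_le_trans m0 (le_trans h1 h2).
have aP : adm (fun y => g x * P.[dotv x y]).
  by apply: admZ; apply: adm_poly_fun; exact: (poly_fun_horner_dotv x sP).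
have aT1 : adm (fun y => 1 - dotv x y) by apply: admB; [exact: adm_cst|exact: adm_dotv].
have aWT : adm (fun y => W y * (1 - dotv x y)) by exact: admM.
have c0 : 0 <= 4 * M * Lc ^+ 2 by rewrite !mulr_ge0// sqr_ge0.
apply: (@le_trans _ _ (4 * M * Lc ^+ 2 * ball_int (fun y => W y * (1 - dotv x y)) +
   2 * M * m^-1 ^+ 2 * eps ^+ 2 * ball_int (fun _ : 'rV[R]_n => 1))); last first.
  rewrite lerD2r ler_wpM2l//; exact: ksq_concentration.
rewrite -(ball_intZ (4 * M * Lc ^+ 2) aWT) -(ball_int_cst n (2 * M * m^-1 ^+ 2 * eps ^+ 2)).
have a1 := admZ (4 * M * Lc ^+ 2) aWT.
have a2 := adm_cst n (2 * M * m^-1 ^+ 2 * eps ^+ 2).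
rewrite -(ball_intD a1 a2); apply: (ball_int_le n0); [|exact: admD|].
  by apply: admM => //; apply: admX; exact: admB.
move=> y y1; have f0 := density_gt0 y1; have /andP[fm fM] := fS y1.
have /andP[g0 gm] := inv_density_bounds x1.
have ht := dotv_sphere_itv x1 y1.
set u := phi x k y * (g y - g x); set v := g x * (phi x k y - P.[dotv x y]).
have -> : (h y - g x * P.[dotv x y]) ^+ 2 * f y = (u + v) ^+ 2 * f y.
  by congr (_ ^+ 2 * _); rewrite /u /v; ring.
have uv : (u + v) ^+ 2 <= 2 * u ^+ 2 + 2 * v ^+ 2.
  rewrite -subr_ge0 (_ : _ - _ = (u - v) ^+ 2) ?sqr_ge0//; by ring.
have hu : u ^+ 2 <= Lc ^+ 2 * (2 * (W y * (1 - dotv x y))).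
  rewrite (_ : Lc ^+ 2 * _ = W y * (Lc ^+ 2 * (2 * (1 - dotv x y)))); last by ring.
  rewrite /u exprMn; apply: (ler_wpM2l (ksq_ge0 x k y)).
  rewrite -(sqr_dist_sphere x1 y1) -sqr_enorm -exprMn -[leLHS]real_normK ?num_real//.
  by rewrite lerXn2r ?nnegrE ?mulr_ge0 ?enorm_ge0//; exact: gL.
have hv : v ^+ 2 <= m^-1 ^+ 2 * eps ^+ 2.
  have b1 : g x ^+ 2 <= m^-1 ^+ 2.
    by rewrite lerXn2r ?nnegrE ?invr_ge0 ?(ltW m0) ?(ltW (density_gt0 x1)).
  have hPt := hP _ ht.
  have b2 : (phi x k y - P.[dotv x y]) ^+ 2 <= eps ^+ 2.
    by rewrite -[leLHS]real_normK ?num_real// lerXn2r ?nnegrE//; exact: le_trans hPt.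
  by rewrite /v exprMn; apply: ler_pM => //; exact: sqr_ge0.
apply: (@le_trans _ _ ((2 * u ^+ 2 + 2 * v ^+ 2) * M)).
  by rewrite ler_pM ?sqr_ge0// ltW.
rewrite mulrDl lerD//.
  rewrite (_ : 4 * M * Lc ^+ 2 * _ = 2 * (Lc ^+ 2 * (2 * (W y * (1 - dotv x y)))) * M); last by ring.
  by rewrite ler_wpM2r// ler_wpM2l.
rewrite (_ : 2 * M * m^-1 ^+ 2 * eps ^+ 2 = 2 * (m^-1 ^+ 2 * eps ^+ 2) * M); last by ring.
by rewrite ler_wpM2r// ler_wpM2l.
Qed.

End projection_error.

(** * Explicit constants and the two rates *)

Section rates.
Variables (R : realType) (n : nat).
Local Notation V := (ball_int (fun _ : 'rV[R]_n => 1)).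

(** N = 2(n + 1) is chosen so that r^(2N) = r^4 r^(4n): the factor r^(4n) pays for the lower bound
    (4kn)^-n / 2 of the kernel mass, with k <= r^4, and r^-4 is the rate to be reached. The last
    factor is the rest of that lower bound. *)
Definition tail_const : R :=
  let N := (2 * n.+1)%N in (2 * expR 1) ^+ 2 * (2 * N%:R) ^+ (2 * N) * V * (2 * (4 * n%:R) ^+ n).

Lemma tail_bound (x : 'rV[R]_n) d r : dotv x x = 1 -> (0 < d)%N -> r = d%:R `^ 3^-1 ->
  (2 * expR 1 * (2 * (2 * n.+1)%:R / r) ^+ (2 * n.+1)) ^+ 2 * V <=
  tail_const / r ^+ 4 * ball_int (ksq x (kdeg R d)).
Proof.
move=> x1 d0 rE; pose N := (2 * n.+1)%N; rewrite -/N; have n0 := sphere_dim_gt0 x1.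
have r1 : 1 <= r by rewrite rE; exact: cbrt_ge1.
have r0 : 0 < r by exact: lt_le_trans r1.
have [k0 kr _] := kdeg_bounds R d0; rewrite -rE in kr.
have V0 : 0 < V by exact: (ball_volume_gt0 x1 k0).
have nR : 0 < n%:R :> R by rewrite ltr0n.
have T0 : 0 <= tail_const / r ^+ 4.
  by rewrite /tail_const !mulr_ge0 ?invr_ge0 ?exprn_ge0 ?mulr_ge0 ?expR_ge0 ?(ltW V0) ?(ltW r0).
apply: (@le_trans _ _ (tail_const / r ^+ 4 * (1 / 2 * (4 * r ^+ 4 * n%:R) ^- n))).
  rewrite le_eqVlt; apply/orP; left; apply/eqP.
  have -> : (4 * r ^+ 4 * n%:R) ^+ n = (4 * n%:R) ^+ n * r ^+ (4 * n).
    by rewrite mulrAC exprMn exprM.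
  have -> : (2 * N%:R / r) ^+ N = (2 * N%:R) ^+ N / r ^+ N by rewrite expr_div_n.
  have -> : (2 * expR 1 * ((2 * N%:R) ^+ N / r ^+ N)) ^+ 2 =
      (2 * expR 1) ^+ 2 * (2 * N%:R) ^+ (2 * N) / r ^+ (2 * N).
    by rewrite [LHS]exprMn expr_div_n -!exprM !(mulnC N 2) mulrA.
  have -> : r ^+ (2 * N) = r ^+ 4 * r ^+ (4 * n) by rewrite -exprD /N mulnA mulnS.
  rewrite /tail_const -/N; set A := (2 * N%:R) ^+ (2 * N).
  have B0 : (4 * n%:R) ^+ n != 0 :> R by rewrite expf_neq0// gt_eqF// mulr_gt0.
  have C0 : r ^+ (4 * n) != 0 by rewrite expf_neq0// gt_eqF.
  move: B0 C0; set B := (4 * n%:R) ^+ n; set C := r ^+ (4 * n) => B0 C0.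
  by field; rewrite B0 C0 gt_eqF.
rewrite ler_wpM2l//; apply: le_trans (ball_int_ksq_lower n0 x1 k0).
rewrite ler_wpM2l ?divr_ge0// lef_pV2 ?posrE ?exprn_gt0 ?mulr_gt0 ?exprn_gt0 ?ltr0n//.
by rewrite lerXn2r ?nnegrE ?mulr_ge0 ?exprn_ge0 ?(ltW r0)// ler_wpM2r ?(ltW nR)// ler_wpM2l.
Qed.

(** This and [taylor_const] are the constants of [sphere_lipschitz] and [sphere_taylor] when the
    oscillation of 1/f is bounded by 1/m. *)
Definition lip_const (m L : R) : R := 2 * `|L| * n%:R + 2 * m^-1.
Definition proj_const (m M L : R) : R :=
  4 * M * lip_const m L ^+ 2 * n%:R + 2 * M * m^-1 ^+ 2 * tail_const.
Definition taylor_const (m L1 L2 : R) : R :=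
  4 * `|L2| * n%:R ^+ 2 + 4 * m^-1 + 2 * `|L1| * n%:R.

Variables (m M L : R) (f : 'rV[R]_n -> R).
Hypotheses (m0 : 0 < m) (fS : forall y, dotv y y = 1 -> m <= f y <= M).
Local Notation g := (fun y => (f y)^-1).
Hypothesis C1 : C1_sphere g L.
Variables (x : 'rV[R]_n) (d : nat) (p : 'rV[R]_n -> R).
Hypotheses (x1 : dotv x x = 1) (d0 : (0 < d)%N).
Hypothesis hp : is_proj d f (fun y => phi x (kdeg R d) y / f y) p.
Local Notation k := (kdeg R d).
Local Notation r := ((d%:R : R) `^ 3^-1).
Local Notation W := (ksq x k).

Lemma lip_const_ge0 : 0 <= lip_const m L.
Proof. by rewrite addr_ge0// !mulr_ge0// invr_ge0 ltW. Qed.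

Lemma inv_density_lipschitz y : dotv y y = 1 -> `|g y - g x| <= lip_const m L * enorm (y - x).
Proof.
by move=> y1; exact: (sphere_lipschitz C1 (inv_density_osc m0 fS) x1 y1).
Qed.

Lemma hom_continuous y : y != 0 -> {for y, continuous (hom_ext g)}.
Proof. exact: (C1_sphere_continuous C1). Qed.

Lemma concentration_rate :
  ball_int (fun y => W y * (1 - dotv x y)) <= n%:R / r ^+ 4 * ball_int W.
Proof.
have [k0 _ rk] := kdeg_bounds R d0.
have n0 := sphere_dim_gt0 x1; have W0 := ball_int_ksq_gt0 x1 k0.
have r0 : 0 < r by exact: lt_le_trans (cbrt_ge1 _ d0).
apply: (le_trans (ksq_concentration n0 x1 k0)).
by rewrite ler_wpM2r ?(ltW W0)// ler_wpM2l// lef_pV2 ?posrE ?exprn_gt0 ?mulr_gt0 ?ltr0n.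
Qed.

(** The projection contributes r^-4 in both regularity classes; only the averaging error [e]
    distinguishes them. *)
Lemma ghat_rate e : `|ball_int (fun y => W y * (g y - g x))| <= e * ball_int W ->
  `|ghat f p x k - g x| <= e + proj_const m M L / r ^+ 4.
Proof.
move=> he; have [k0 _ rk] := kdeg_bounds R d0.
have n0 := sphere_dim_gt0 x1; have W0 := ball_int_ksq_gt0 x1 k0.
have r0 : 0 < r by exact: lt_le_trans (cbrt_ge1 _ d0).
have M0 : 0 <= M by case/andP: (fS x1) => h1 h2; apply: ltW; apply: lt_le_trans m0 (le_trans h1 h2).
have N0 : (0 < 2 * n.+1)%N by [].
have [P sP hP] := kernel_approx_scale R d0 N0.
have hq : poly_fun d (fun y => g x * P.[dotv x y]).
  by apply: poly_funZ; exact: poly_fun_horner_dotv.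
apply: (le_trans (ghat_error m0 fS hom_continuous x1 k0 hp hq)).
rewrite ler_pdivrMr// mulrDl lerD//.
have := approx_error m0 fS hom_continuous x1 k0 lip_const_ge0 inv_density_lipschitz hP sP.
move=> /le_trans; apply.
have -> : proj_const m M L / r ^+ 4 * ball_int W =
    4 * M * lip_const m L ^+ 2 * (n%:R / r ^+ 4 * ball_int W) +
    2 * M * m^-1 ^+ 2 * (tail_const / r ^+ 4 * ball_int W) by rewrite /proj_const; ring.
apply: lerD.
  rewrite ler_wpM2l ?mulr_ge0 ?lip_const_ge0// ler_wpM2r ?(ltW W0)// ler_wpM2l//.
  by rewrite lef_pV2 ?posrE ?exprn_gt0 ?mulr_gt0 ?ltr0n.
rewrite -[leLHS]mulrA ler_wpM2l ?mulr_ge0 ?invr_ge0 ?(ltW m0)//.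
exact: (tail_bound x1 d0 erefl).
Qed.

Lemma ghat_rate_C1 : `|ghat f p x k - g x| <=
  (lip_const m L * (n%:R + 1) + `|proj_const m M L|) / r ^+ 2.
Proof.
have [k0 _ rk] := kdeg_bounds R d0.
have n0 := sphere_dim_gt0 x1; have W0 := ball_int_ksq_gt0 x1 k0.
have r1 : 1 <= r by exact: cbrt_ge1.
have r0 : 0 < r by exact: lt_le_trans r1.
have ag := adm_inv_density m0 fS hom_continuous; have aW := adm_ksq x k.
have aT1 : adm (fun y => 1 - dotv x y) by apply: admB; [exact: adm_cst|exact: adm_dotv].
have aWT : adm (fun y => W y * (1 - dotv x y)) by exact: admM.
have agx : adm (fun y => W y * (g y - g x)) by apply: admM => //; apply: admB => //; exact: adm_cst.
have Lc := lip_const_ge0.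
have r2 : 0 < r ^+ 2 by rewrite exprn_gt0.
(* A pointwise majorant in place of Cauchy-Schwarz: the weight r^2 balances the concentration
   integral, of relative size r^-4, against r^-2 times the mass. *)
pose B y := lip_const m L * (r ^+ 2 * (W y * (1 - dotv x y)) + r ^- 2 * W y).
have aB : adm B by apply: admZ; apply: admD; apply: admZ.
have IB : ball_int B = lip_const m L * (r ^+ 2 * ball_int (fun y => W y * (1 - dotv x y)) + r ^- 2 * ball_int W).
  have a1 := admZ (r ^+ 2) aWT; have a2 := admZ (r ^- 2) aW.
  rewrite -(ball_intZ (r ^+ 2) aWT) -(ball_intZ (r ^- 2) aW) -(ball_intD a1 a2).
  by rewrite -(ball_intZ _ (admD a1 a2)).
have hB y : dotv y y = 1 -> `|W y * (g y - g x)| <= B y.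
  move=> y1; rewrite normrM (ger0_norm (ksq_ge0 x k y)).
  rewrite (_ : B y = W y * (lip_const m L * (r ^+ 2 * (1 - dotv x y) + r ^- 2))); last by rewrite /B; ring.
  apply: (ler_wpM2l (ksq_ge0 x k y)); apply: (le_trans (inv_density_lipschitz y1)).
  rewrite ler_wpM2l//.
  have := sqr_dist_sphere x1 y1; rewrite -sqr_enorm; set e := enorm _ => ee.
  (* AM-GM: [e <= (r^2 e^2 + r^-2) / 2] *)
  have : 0 <= (r * e - r^-1) ^+ 2 by exact: sqr_ge0.
  rewrite sqrrB exprMn ee exprVn (_ : r * e * r^-1 = e); last by field; rewrite gt_eqF.
  have : 0 <= r ^- 2 by rewrite invr_ge0 ltW.
  lra.
have E : `|ball_int (fun y => W y * (g y - g x))| <= ball_int B.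
  rewrite ler_norml; apply/andP; split.
    rewrite -(ball_intN aB); apply: (ball_int_le n0 (admN aB) agx) => y /hB.
    by rewrite ler_norml => /andP[].
  by apply: (ball_int_le n0 agx aB) => y /hB; rewrite ler_norml => /andP[].
have he : `|ball_int (fun y => W y * (g y - g x))| <= lip_const m L * (n%:R + 1) / r ^+ 2 * ball_int W.
  apply: (le_trans E); rewrite IB.
  have -> : lip_const m L * (n%:R + 1) / r ^+ 2 * ball_int W =
      lip_const m L * (r ^+ 2 * (n%:R / r ^+ 4 * ball_int W) + r ^- 2 * ball_int W).
    by field; rewrite gt_eqF.
  by rewrite ler_wpM2l// lerD2r ler_wpM2l ?(ltW r2)// concentration_rate.
apply: (le_trans (ghat_rate he)).
(* As r >= 1, r^-4 <= r^-2; the absolute value makes the constant nonnegative for this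
   comparison. *)
rewrite [leRHS]mulrDl lerD// (le_trans (ler_norm _))// normrM ler_wpM2l//.
rewrite ger0_norm ?invr_ge0 ?exprn_ge0 ?(ltW r0)// lef_pV2 ?posrE ?exprn_gt0//.
by rewrite ler_weXn2l.
Qed.

(** By the first moment identity the kernel integral of y - x is -I x, where I is the integral of W
    (1 - <x, y>). The linear term is thus -<a, x> I, of the same order as the integrated quadratic
    remainder, and |<a, x>| <= |L| n suffices. *)
Lemma ghat_rate_C2 L2 : C2_sphere g L L2 -> `|ghat f p x k - g x| <=
  ((`|L| * n%:R + 2 * taylor_const m L L2) * n%:R + proj_const m M L) / r ^+ 4.
Proof.
move=> C2; have [k0 _ rk] := kdeg_bounds R d0.
have n0 := sphere_dim_gt0 x1; have W0 := ball_int_ksq_gt0 x1 k0.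
have [a aL ha] := sphere_taylor C2 (inv_density_osc m0 fS) x1.
rewrite -/(taylor_const m L L2) in ha.
have ag := adm_inv_density m0 fS hom_continuous; have aW := adm_ksq x k.
have aT := adm_dotv x.
have aT1 : adm (fun y => 1 - dotv x y) by apply: admB => //; exact: adm_cst.
have aWT : adm (fun y => W y * (1 - dotv x y)) by exact: admM.
have aWa : adm (fun y => W y * dotv a (y - x)).
  apply: admM => //; under eq_fun do rewrite dotvDr.
  by apply: admD; [exact: adm_dotv|exact: adm_cst].
have agx : adm (fun y => W y * (g y - g x)) by apply: admM => //; apply: admB => //; exact: adm_cst.
set I := ball_int (fun y => W y * (1 - dotv x y)).
have I0 : 0 <= I.
  rewrite -(ball_int_0 R n); apply: (ball_int_le n0 (adm_cst n 0) aWT) => y y1.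
  by rewrite mulr_ge0 ?ksq_ge0// subr_ge0; case/andP: (dotv_sphere_itv x1 y1).
have E1 : ball_int (fun y => W y * dotv a (y - x)) = - dotv a x * I.
  have aWc i : adm (fun y => W y * y 0 i) by apply: admM => //; exact: adm_coord.
  have aWcx i : adm (fun y => W y * y 0 i - x 0 i * W y) by apply: admB => //; exact: admZ.
  have EI : I = ball_int W - ball_int (fun y => W y * dotv x y).
    rewrite /I -(ball_intB aW (admM aW aT)); congr ball_int; apply/funext => y; ring.
  rewrite (_ : (fun y => W y * dotv a (y - x)) = (fun y => \sum_i a 0 i * (W y * y 0 i - x 0 i * W y))).
    rewrite ball_int_sum; last by move=> i _; exact: admZ.
    rewrite EI /dotv mulNr mulr_suml -sumrN; apply: eq_bigr => i _.
    rewrite (ball_intZ _ (aWcx i)) (ball_intB (aWc i) (admZ _ aW)) (ball_intZ _ aW).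
    by rewrite (ksq_moment_first n0 x1); ring.
  apply/funext => y; rewrite /dotv mulr_sumr; apply: eq_bigr => i _.
  by rewrite !mxE; ring.
have K0 : 0 <= taylor_const m L L2.
  by rewrite !addr_ge0// ?mulr_ge0 ?exprn_ge0// invr_ge0 ltW.
have aK := admZ (2 * taylor_const m L L2) aWT.
have adiff := admB agx aWa.
have hK y : dotv y y = 1 -> `|W y * (g y - g x) - W y * dotv a (y - x)| <=
    2 * taylor_const m L L2 * (W y * (1 - dotv x y)).
  move=> y1; rewrite -mulrBr normrM (ger0_norm (ksq_ge0 x k y)).
  rewrite (_ : 2 * _ * _ = W y * (taylor_const m L L2 * (2 * (1 - dotv x y)))); last by ring.
  apply: (ler_wpM2l (ksq_ge0 x k y)).
  by rewrite -(sqr_dist_sphere x1 y1) -sqr_enorm; exact: ha.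
have E2 : `|ball_int (fun y => W y * (g y - g x)) - ball_int (fun y => W y * dotv a (y - x))| <=
    2 * taylor_const m L L2 * I.
  rewrite -(ball_intB agx aWa) -(ball_intZ _ aWT) ler_norml; apply/andP; split.
    rewrite -(ball_intN aK); apply: (ball_int_le n0 (admN aK) adiff) => y /hK.
    by rewrite ler_norml => /andP[].
  by apply: (ball_int_le n0 adiff aK) => y /hK; rewrite ler_norml => /andP[].
have da : `|dotv a x| <= `|L| * n%:R.
  rewrite (le_trans (ler_norm_sum _ _ _))// (@le_trans _ _ (\sum_(i < n) `|L|))//.
    apply: ler_sum => i _; rewrite normrM -[leRHS]mulr1 ler_pM//.
    exact: coord_sphere_le1.
  by rewrite sumr_const card_ord mulr_natr.
have he : `|ball_int (fun y => W y * (g y - g x))| <=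
    (`|L| * n%:R + 2 * taylor_const m L L2) * n%:R / r ^+ 4 * ball_int W.
  apply: (@le_trans _ _ ((`|L| * n%:R + 2 * taylor_const m L L2) * I)).
    move: E2; rewrite E1; set J := ball_int _ => E2.
    rewrite -[J](subrK (- dotv a x * I)) (le_trans (ler_normD _ _))// addrC [leRHS]mulrDl lerD//.
    by rewrite normrM normrN (ger0_norm I0) ler_wpM2r.
  rewrite -[X in _ <= X * _]mulrA -[leRHS]mulrA ler_wpM2l//; last exact: concentration_rate.
  by rewrite addr_ge0// mulr_ge0.
by apply: (le_trans (ghat_rate he)); rewrite -mulrDl.
Qed.

End rates.

Theorem theorem4p14 (R : realType) (n : nat) (m M : R) :
  0 < m -> m <= M ->
  (forall L : R, exists C : R,
     forall f : 'rV[R]_n -> R,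
       density_ok f m M -> C1_sphere (fun y => (f y)^-1) L ->
       forall (d : nat), (0 < d)%N -> forall x : 'rV[R]_n, @sphere R n x ->
       forall p : 'rV[R]_n -> R,
         is_proj d f (fun y => phi x (kdeg R d) y / f y) p ->
         `|ghat f p x (kdeg R d) - (f x)^-1| <= C / (d%:R `^ (2 / 3)))
  /\
  (forall L1 L2 : R, exists C : R,
     forall f : 'rV[R]_n -> R,
       density_ok f m M -> C2_sphere (fun y => (f y)^-1) L1 L2 ->
       forall (d : nat), (0 < d)%N -> forall x : 'rV[R]_n, @sphere R n x ->
       forall p : 'rV[R]_n -> R,
         is_proj d f (fun y => phi x (kdeg R d) y / f y) p ->
         `|ghat f p x (kdeg R d) - (f x)^-1| <= C / (d%:R `^ (4 / 3))).
Proof.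
move=> m0 _; split.
  (* The constant is fixed before the density, the degree and the point, which is the required
     uniformity. *)
  move=> L; exists (lip_const n m L * (n%:R + 1) + `|proj_const n m M L|).
  move=> f [fS _] C1 d d0 x x1 p hp; rewrite powR_cbrt.
  exact: (ghat_rate_C1 m0 fS C1 x1 d0 hp).
move=> L1 L2; exists ((`|L1| * n%:R + 2 * taylor_const n m L1 L2) * n%:R + proj_const n m M L1).
move=> f [fS _] C2 d d0 x x1 p hp; rewrite powR_cbrt.
exact: (ghat_rate_C2 m0 fS C2.1 x1 d0 hp C2).
Qed.
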